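(* Let $(M,g)$ be a Lorentzian 4-manifold, oriented and time-oriented by a reference coframe, and consider the action $$S_{\mathrm{tele}}(\vartheta)=\int l\wedge T^{\mathrm{ax}},\qquad l:=\vartheta^0+\vartheta^3,\qquad T^{\mathrm{ax}}:=\tfrac13\,o_{jk}\,\vartheta^j\wedge d\vartheta^k,$$ on coframes $\vartheta$, with the metric $g$ fixed. Put $m:=\vartheta^1+i\vartheta^2$ and $$v_\alpha:=\{\nabla\}^\beta(l\wedge m)_{\alpha\beta}-m^\beta\{\nabla\}_\alpha l_\beta .$$ Then a coframe $\vartheta$ satisfies the Euler--Lagrange field equations obtained by varying $S_{\mathrm{tele}}$ with respect to the coframe subject to the metric constraint $g=o_{jk}\,\vartheta^j\otimes\vartheta^k$ if and only if $$v=0 .$$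
   Context: All objects are smooth. $M$ is a 4-manifold with a prescribed Lorentzian metric $g$ (not necessarily flat) of signature $(+,-,-,-)$; everything is local, so $M$ is understood to be a small (contractible) coordinate neighbourhood of a point, on which a fixed reference coframe $\boldsymbol\vartheta$ is given. Summation over repeated indices is used; Greek indices are tensor indices, raised and lowered with $g$; $o_{jk}=o^{jk}=\operatorname{diag}(1,-1,-1,-1)$. $(u\wedge w)_{\alpha\beta}=u_\alpha w_\beta-u_\beta w_\alpha$ for covectors; $d$ is the exterior derivative; $\{\nabla\}$ is the Levi-Civita covariant derivative of $g$ (extended complex-linearly to complex tensors). A coframe is a quartet of real covector fields $\vartheta^j$, $j=0,1,2,3$, with $g=o_{jk}\,\vartheta^j\otimes\vartheta^k$, $\det\vartheta^j_\alpha>0$ in local coordinates with $\det\boldsymbol\vartheta^j_\alpha>0$, and $g(\boldsymbol\vartheta^0,\vartheta^0)>0$ (inner product on covectors). Variations subject to the metric constraint are $\delta\vartheta^j=F^j{}_k\vartheta^k$, where $F^j{}_k$ are arbitrary compactly supported real scalar functions with $F_{jk}=-F_{kj}$, $F_{jk}:=o_{ji}F^i{}_k$. The Euler--Lagrange field equations say that the corresponding first variation $\delta S_{\mathrm{tele}}$ vanishes for all such $F$. *)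

(* Defs.v *)
From HB Require Import structures.
From mathcomp Require Import all_boot all_order all_algebra.
From mathcomp Require Import complex.
From mathcomp Require Import all_classical all_reals all_analysis.

Set Implicit Arguments.
Unset Strict Implicit.
Unset Printing Implicit Defensive.

Import Order.TTheory GRing.Theory Num.Theory.
Import numFieldNormedType.Exports.

Local Open Scope classical_set_scope.
Local Open Scope ring_scope.

(* M is a coordinate neighbourhood, i.e. an open U in R^4.  Tensor fields are
   given by their coordinate components, the point being the last argument;
   they are total functions of which only the values on U matter. *)
Notation point R := 'rV[R]_4.
Notation covector R K := ('I_4 -> point R -> K).
Notation tensor2 R K := ('I_4 -> 'I_4 -> point R -> K).
Notation tensor3 R K := ('I_4 -> 'I_4 -> 'I_4 -> point R -> K).

(* A quartet of covectors: [theta j a x] is the component with coordinate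
   index [a] of the covector theta^j at x. *)
Notation quartet R := ('I_4 -> covector R R).

Definition partial (R : realType) (a : 'I_4) (f : point R -> R) : point R -> R :=
  fun x => 'D_(delta_mx 0 a) f x.

(* C^oo on the open set U: every iterated partial derivative is
   (Frechet) differentiable on U. *)
Definition smooth (R : realType) (U : set (point R)) (f : point R -> R) : Prop :=
  forall (s : seq 'I_4) (x : point R), U x ->
    differentiable (foldr (@partial R) f s) x.

Definition contractible (R : realType) (U : set (point R)) : Prop :=
  exists2 p, U p &
  exists H : R * point R -> point R,
    [/\ {within `[0, 1] `*` U, continuous H},
        forall t x, t \in `[0, 1] -> U x -> U (H (t, x)),
        forall x, U x -> H (0, x) = x
      & forall x, U x -> H (1, x) = p].

(* diag(1, -1, -1, -1) *)
Definition o (R : realType) (j k : 'I_4) : R :=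
  if j != k then 0 else if j == ord0 then 1 else -1.

Definition omx (R : realType) : 'M[R]_4 := \matrix_(j, k) o R j k.

Definition mx_at (R : realType) (T : tensor2 R R) (x : point R) : 'M[R]_4 :=
  \matrix_(a, b) T a b x.

(* Signature (+,-,-,-): congruence to diag(1,-1,-1,-1). *)
Definition lorentzian (R : realType) (U : set (point R)) (g : tensor2 R R) : Prop :=
  [/\ forall a b, smooth U (g a b),
      forall a b x, U x -> g a b x = g b a x
    & forall x, U x ->
        exists2 P : 'M[R]_4, P \in unitmx & mx_at g x = P^T *m omx R *m P].

Definition ginv (R : realType) (g : tensor2 R R) (a b : 'I_4) (x : point R) : R :=
  invmx (mx_at g x) a b.

Definition inner (R : realType) (g : tensor2 R R) (u w : covector R R)
    (x : point R) : R :=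
  \sum_a \sum_b ginv g a b x * u a x * w b x.

(* g = o_{jk} theta^j (x) theta^k on U *)
Definition metric_constraint (R : realType) (U : set (point R))
    (g : tensor2 R R) (theta : quartet R) : Prop :=
  forall a b x, U x ->
    g a b x = \sum_j \sum_k o R j k * theta j a x * theta k b x.

(* The coordinates on U are taken to be positively oriented with respect to
   the reference coframe [ref]. *)
Definition reference_coframe (R : realType) (U : set (point R))
    (g : tensor2 R R) (ref : quartet R) : Prop :=
  [/\ forall j a, smooth U (ref j a),
      metric_constraint U g ref
    & forall x, U x -> 0 < \det (mx_at ref x)].

Definition coframe (R : realType) (U : set (point R))
    (g : tensor2 R R) (ref theta : quartet R) : Prop :=
  [/\ forall j a, smooth U (theta j a),
      metric_constraint U g theta,
      forall x, U x -> 0 < \det (mx_at theta x)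
    & forall x, U x -> 0 < inner g (ref ord0) (theta ord0) x].

(* Exterior calculus, with the normalisation
   (u /\ w)_{ab} = u_a w_b - u_b w_a. *)
Definition wedge11 (R : realType) (K : comPzRingType) (u w : covector R K) :
    tensor2 R K :=
  fun a b x => u a x * w b x - u b x * w a x.

Definition wedge12 (R : realType) (u : covector R R) (w : tensor2 R R) :
    tensor3 R R :=
  fun a b c x => u a x * w b c x + u b x * w c a x + u c x * w a b x.

(* The 0123-component of the 4-form u /\ w. *)
Definition wedge13_0123 (R : realType) (u : covector R R) (w : tensor3 R R)
    (x : point R) : R :=
  let i0 := inord 0 in let i1 := inord 1 in
  let i2 := inord 2 in let i3 := inord 3 in
  u i0 x * w i1 i2 i3 x - u i1 x * w i0 i2 i3 x
  + u i2 x * w i0 i1 i3 x - u i3 x * w i0 i1 i2 x.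

Definition ext_d (R : realType) (u : covector R R) : tensor2 R R :=
  fun a b x => partial a (u b) x - partial b (u a) x.

Definition lcov (R : realType) (theta : quartet R) : covector R R :=
  fun a x => theta (inord 0) a x + theta (inord 3) a x.

Definition axial_torsion (R : realType) (theta : quartet R) : tensor3 R R :=
  fun a b c x =>
    3^-1 * \sum_j \sum_k o R j k * wedge12 (theta j) (ext_d (theta k)) a b c x.

(* The coefficient of dx^0 /\ dx^1 /\ dx^2 /\ dx^3 in l /\ T^ax. *)
Definition lagrangian (R : realType) (theta : quartet R) : point R -> R :=
  wedge13_0123 (lcov theta) (axial_torsion theta).

Definition pt4 (R : realType) (x0 x1 x2 x3 : R) : point R :=
  \row_(a < 4) nth 0 [:: x0; x1; x2; x3] a.

(* Integral over U of the 4-form f dx^0 /\ dx^1 /\ dx^2 /\ dx^3 as an iterated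
   integral; it is only used for f continuous with compact support in U. *)
Definition integral_on (R : realType) (U : set (point R)) (f : point R -> R) : R :=
  let mu := @lebesgue_measure R in
  \int[mu]_x0 \int[mu]_x1 \int[mu]_x2 \int[mu]_x3 (f \_ U) (pt4 x0 x1 x2 x3).

(* S(theta') - S(theta).  S itself need not converge on U; for theta' = theta
   off a compact subset of U the difference of the integrands has compact
   support. *)
Definition action_diff (R : realType) (U : set (point R))
    (theta' theta : quartet R) : R :=
  integral_on U (fun x => lagrangian theta' x - lagrangian theta x).

(* The functions F^j_k, [F j k] having j as its upper index. *)
Definition admissible (R : realType) (U : set (point R)) (F : tensor2 R R) : Prop :=
  [/\ forall j k, smooth U (F j k),
      exists K : set (point R), [/\ compact K, K `<=` U
        & forall j k x, ~ K x -> F j k x = 0]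
    & forall j k x,
        \sum_i o R j i * F i k x = - \sum_i o R k i * F i j x].

(* theta^j + eps F^j_k theta^k *)
Definition varied (R : realType) (theta : quartet R) (F : tensor2 R R) (eps : R) :
    quartet R :=
  fun j a x => theta j a x + eps * \sum_k F j k x * theta k a x.

(* The first variation d/d(eps) S(theta + eps F theta) at eps = 0 vanishes for
   all F. *)
Definition euler_lagrange (R : realType) (U : set (point R)) (theta : quartet R) :
    Prop :=
  forall F, admissible U F ->
    is_derive (0 : R) (1 : R)
      (fun eps : R => action_diff U (varied theta F eps) theta) (0 : R).

(* Gamma^d_{ab} *)
Definition christoffel (R : realType) (g : tensor2 R R) (d a b : 'I_4)
    (x : point R) : R :=
  2^-1 * \sum_s ginv g d s x *
    (partial a (g s b) x + partial b (g s a) x - partial s (g a b) x).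

(* nabla_c u_a *)
Definition cov1 (R : realType) (g : tensor2 R R) (u : covector R R)
    (c a : 'I_4) (x : point R) : R :=
  partial c (u a) x - \sum_d christoffel g d c a x * u d x.

(* nabla_c T_{ab} *)
Definition cov2 (R : realType) (g : tensor2 R R) (T : tensor2 R R)
    (c a b : 'I_4) (x : point R) : R :=
  partial c (T a b) x - \sum_d christoffel g d c a x * T d b x
                      - \sum_d christoffel g d c b x * T a d x.

Definition cov2C (R : realType) (g : tensor2 R R) (T : tensor2 R R[i])
    (c a b : 'I_4) (x : point R) : R[i] :=
  Complex (cov2 g (fun a b x => complex.Re (T a b x)) c a b x)
          (cov2 g (fun a b x => complex.Im (T a b x)) c a b x).

Definition mcov (R : realType) (theta : quartet R) : covector R R[i] :=
  fun a x => Complex (theta (inord 1) a x) (theta (inord 2) a x).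

(* v_a = nabla^b (l /\ m)_{ab} - m^b nabla_a l_b *)
Definition vcov (R : realType) (g : tensor2 R R) (theta : quartet R)
    (a : 'I_4) (x : point R) : R[i] :=
  let l := lcov theta in
  let lC : covector R R[i] := fun a x => (l a x)%:C%C in
  let m := mcov theta in
  \sum_b \sum_c (ginv g b c x)%:C%C * cov2C g (wedge11 lC m) c a b x
  - \sum_b (\sum_c (ginv g b c x)%:C%C * m c x) * (cov1 g l a b x)%:C%C.

(* Main.v *)
Require Import Defs.
From mathcomp Require Import all_boot all_order all_algebra.
From mathcomp Require Import complex ring lra.
From mathcomp Require Import all_classical all_reals all_analysis.
Import Order.TTheory GRing.Theory Num.Theory.
Import numFieldNormedType.Exports.
Local Open Scope classical_set_scope.
Local Open Scope ring_scope.

(** Under [delta theta^j = F^j_k theta^k] the first variation of the Lagrangian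
    is the exterior derivative of [1/3 o_jk F^j_m l /\ theta^k /\ theta^m] plus
    an expression that is linear in [F] and free of derivatives of [F].  The
    former integrates to zero; testing with bump functions, the field equations
    say that the latter vanishes pointwise for all constant antisymmetric [F].
    Let W be the frame components of the Levi-Civita derivatives of the
    [theta^j]: torsion-freeness expresses [d theta^j] through W, and metric
    compatibility makes W antisymmetric in its first and last index.  In terms
    of W the algebraic expression is [2 det theta] times
      F_01 v''_0 - F_02 v'_0 + F_03 v'_2 - F_12 v'_1 - F_13 v''_0 + F_23 v'_0
    where v', v'' are the real and imaginary parts of the frame components of
    v (the [F_jk] having their first index up), while v'_3 = v'_0,
    v''_3 = v''_0, v''_2 = v'_1 and v''_1 = - v'_2. *)

(** The Lagrangian is trilinear in l, the coframe entering T^ax and its derivatives, so along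
    [theta + eps F theta] the action difference is exactly a cubic polynomial in eps. The first
    variation is its linear coefficient, and no differentiation in eps under the integral is
    involved. The integral is an iterated one, so integrated divergences are shown to vanish one
    variable at a time: a derivative is carried outward through the inner integrals until its own
    variable is integrated.

    The relations among the frame components of v confine it to the span of l and m, so v = 0
    amounts to four real equations, against six parameters in F. Correspondingly the directions F_01
    = F_13, F_02 = F_23, F_03 = F_12 = 0 drop out of the algebraic expression: these are the
    infinitesimal null rotations, which fix l. *)

(** * One-variable Lebesgue integrals of continuous functions with bounded support *)

Section OneVariable.
Context {R : realType}.
Notation mu := (@lebesgue_measure R).
Implicit Types (h : R -> R) (N M : R).

Lemma supp_patch h N : (forall t, N < `|t| -> h t = 0) ->
  h \_ `[- N, N] = h.
Proof.
move=> h0; apply/funext => t; rewrite patchE; case: ifPn => // tN.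
apply/esym/h0; rewrite ltNge; apply: contra tN => tN.
by rewrite inE/= in_itv/= -ler_norml.
Qed.

Lemma continuous_itv_integrable f (a b : R) : continuous f ->
  mu.-integrable `[a, b] (EFin \o f).
Proof.
by move=> cf; apply: continuous_compact_integrable;
  [exact: segment_compact | exact: continuous_subspaceT].
Qed.

Lemma cst_itv_integrable (a b c : R) : mu.-integrable `[a, b] (EFin \o cst c).
Proof. by apply: continuous_itv_integrable => t; exact: cvg_cst. Qed.

Lemma continuous_supp_integrable h N : continuous h ->
  (forall t, N < `|t| -> h t = 0) -> mu.-integrable setT (EFin \o h).
Proof.
move=> ch h0; rewrite -(supp_patch h N h0).
have -> : EFin \o (h \_ `[- N, N]) = (EFin \o h) \_ `[- N, N].
  by rewrite restrict_EFin.
have mN : measurable (`[- N, N] : set R) by [].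
apply: ((integrable_mkcond (mu := mu) (EFin \o h) mN).1 _).
exact: continuous_itv_integrable.
Qed.

Lemma supp_Rintegral h N : (forall t, N < `|t| -> h t = 0) ->
  (\int[mu]_t h t = \int[mu]_(t in `[- N, N]) h t)%R.
Proof. by move=> h0; rewrite [RHS]Rintegral_mkcond supp_patch. Qed.

Lemma Rintegral_supp_bound h N M : 0 < N -> continuous h ->
  (forall t, N < `|t| -> h t = 0) -> (forall t, `|h t| <= M) ->
  `|(\int[mu]_t h t)%R| <= M * (N + N).
Proof.
move=> N0 ch h0 hM; rewrite (supp_Rintegral _ N)//.
apply: (le_trans (le_normr_Rintegral _ _)) => //; first exact: continuous_itv_integrable.
apply: (@le_trans _ _ (\int[mu]_(t in `[- N, N]) (cst M t))%R).
  apply: le_Rintegral => //.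
  - by apply: (continuous_itv_integrable (fun t => `|h t|)) => t; apply: continuous_comp;
      [exact: ch | exact: norm_continuous].
  - exact: cst_itv_integrable.
rewrite Rintegral_cst//= lebesgue_measure_itv/= lte_fin ifT; last by lra.
by rewrite -EFinB/= opprK.
Qed.

(** By continuity [h] exceeds [h p / 2] on an interval of length [2 d] about [p], and the integral
    over the line is at least the one over this interval. *)
Lemma Rintegral_gt0 h N p : continuous h ->
  (forall t, N < `|t| -> h t = 0) -> (forall t, 0 <= h t) -> 0 < h p ->
  0 < (\int[mu]_t h t)%R.
Proof.
move=> ch h0 hge hp.
have ih := continuous_supp_integrable _ _ ch h0.
have hp2 : h p / 2 < h p by lra.
have [d /= d0 hd] : nbhs_ball p [set t | h p / 2 < h t].
  by apply/nbhs_ballP; exact: (cvgr_gt (h p) (ch p) _ hp2).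
pose D := `](p - d)%R, (p + d)%R[%classic : set R.
have mD : measurable D by exact: measurable_itv.
have inD t : D t -> h p / 2 < h t.
  move=> tD; apply: hd; rewrite -ball_normE/=; move: tD.
  by rewrite /D/= in_itv/= => /andP[a b]; rewrite ltr_norml; apply/andP; split; lra.
have iD : mu.-integrable D (EFin \o h) by apply: integrableS ih.
apply: (@lt_le_trans _ _ (\int[mu]_(t in D) h t)%R); last first.
  rewrite /Rintegral fine_le//; [exact: integrable_fin_num|exact: integrable_fin_num|].
  apply: ge0_subset_integral => //; last by move=> x _; rewrite lee_fin.
  by case/integrableP: ih.
apply: (@lt_le_trans _ _ (\int[mu]_(t in D) (cst (h p / 2) t))%R); last first.
  apply: le_Rintegral => //; last by move=> t /inD /ltW.
  apply: (@integrableS _ _ _ mu `[p - d, p + d]) => //.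
    by move=> t /=; rewrite !in_itv/= => /andP[/ltW-> /ltW->].
  exact: cst_itv_integrable.
rewrite Rintegral_cst// /D/= lebesgue_measure_itv/= lte_fin ifT; last by lra.
by rewrite -EFinB/= mulr_gt0//; lra.
Qed.

(** Dominated convergence: the support condition replaces the line by [[-N, N]], on which the
    constant [M] is integrable. *)
Lemma continuous_parameter_Rintegral (h : R -> R -> R) N M : 0 < N ->
  (forall s, continuous (h s)) -> (forall t, continuous (h ^~ t)) ->
  (forall s t, N < `|t| -> h s t = 0) -> (forall s t, `|h s t| <= M) ->
  continuous (fun s => \int[mu]_t h s t)%R.
Proof.
move=> N0 c1 c2 h0 hM s0.
have -> : (fun s => \int[mu]_t h s t)%R
   = (fun s => \int[mu]_(t in `[- N, N]) h s t)%R.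
  by apply/funext => s; apply: supp_Rintegral => t; exact: h0.
apply: (@continuity_under_integral R _ _ mu h _ _ (s0 - 1) (s0 + 1) _ _ (cst M)) => //.
- by move=> s _; exact: continuous_itv_integrable.
- by apply: aeW => t _ s _; exact: c2.
- exact: cst_itv_integrable.
- by move=> s _; apply: aeW => t _; exact: hM.
- by rewrite inE/= in_itv/=; apply/andP; split; lra.
Qed.

Lemma derive_parameter_Rintegral (h k : R -> R -> R) N M (s0 : R) : 0 < N ->
  (forall s, continuous (h s)) -> (forall s, continuous (k s)) ->
  (forall s t, N < `|t| -> h s t = 0) -> (forall s t, N < `|t| -> k s t = 0) ->
  (forall s t, `|k s t| <= M) ->
  (forall s t : R, is_derive s 1 (h ^~ t) (k s t)) ->
  is_derive s0 1 (fun s => \int[mu]_t h s t)%R (\int[mu]_t k s0 t)%R.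
Proof.
move=> N0 c1 c2 h0 k0 kM dh.
have -> : (fun s => \int[mu]_t h s t)%R
   = (fun s => \int[mu]_(t in `[- N, N]) h s t)%R.
  by apply/funext => s; apply: supp_Rintegral => t; exact: h0.
rewrite (supp_Rintegral _ N); last by move=> t; exact: k0.
have Is0 : `](s0 - 1), (s0 + 1)[%classic s0 by rewrite /= in_itv/=; apply/andP; split; lra.
have M0 : 0 <= M by apply: le_trans (kM 0 0).
have d1 s t : partial1of2 h s t = k s t.
  by rewrite partial1of2E; have dd := dh s t; rewrite derive_val.
have H1 : forall x, `](s0 - 1), (s0 + 1)[%classic x ->
   mu.-integrable `[- N, N] (EFin \o h x) by move=> x _; exact: continuous_itv_integrable.
have H2 : forall x y, `](s0 - 1), (s0 + 1)[%classic x -> `[- N, N]%classic y ->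
   derivable (h ^~ y) x 1.
  by move=> x y _ _; have dd := dh x y; exact: ex_derive.
have H3 : mu.-integrable `[- N, N] (EFin \o cst M)
  by exact: cst_itv_integrable.
have H4 : forall x y, `](s0 - 1), (s0 + 1)[%classic x -> `[- N, N]%classic y ->
   `|partial1of2 h x y| <= cst M y by move=> x y _ _; rewrite d1; exact: kM.
have mN : measurable (`[- N, N] : set R) by [].
have der := @derivable_under_integral R _ _ mu h _ mN s0 _ _ Is0 H1 H2 (cst M) (fun=> M0) H3 H4.
have := @differentiation_under_integral R _ _ mu h _ mN s0 _ _ Is0 H1 H2 (cst M) (fun=> M0) H3 H4.
rewrite derive1E => der2.
apply: DeriveDef => //; rewrite der2.
by apply: eq_Rintegral => t _; rewrite d1.
Qed.

Lemma Rintegral_derive0 (h k : R -> R) N : 0 < N -> continuous k ->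
  (forall t, N < `|t| -> h t = 0) -> (forall t, N < `|t| -> k t = 0) ->
  (forall t : R, is_derive t 1 h (k t)) -> (\int[mu]_t k t = 0)%R.
Proof.
move=> N0 ck h0 k0 dh.
(* The support condition is strict and says nothing at [-N] and [N]. At the ends of the larger
   interval [h] vanishes, so the fundamental theorem of calculus gives 0. *)
have k0' t : N + 1 < `|t| -> k t = 0 by move=> ?; apply: k0; lra.
rewrite (supp_Rintegral _ (N + 1))// /Rintegral.
have ch : continuous h.
  move=> t; apply/differentiable_continuous/derivable1_diffP.
  by have dd := dh t; exact: ex_derive.
rewrite (@continuous_FTC2 R k h (- (N + 1)) (N + 1)); first last.
- by move=> t _; rewrite derive1E; have dd := dh t; rewrite derive_val.
- split.
  + by move=> t _; have dd := dh t; exact: ex_derive.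
  + exact/cvg_at_right_filter/ch.
  + exact/cvg_at_left_filter/ch.
- exact: continuous_subspaceT.
- lra.
by rewrite !h0 ?normrN ?gtr0_norm ?subee//; lra.
Qed.

End OneVariable.

(** * Iterated integrals over R^4 *)

Section IteratedIntegral.
Context {R : realType}.
Notation mu := (@lebesgue_measure R).
Implicit Types (f k : 'rV[R]_4 -> R) (x : 'rV[R]_4) (S : {set 'I_4}).

Definition upd (x : 'rV[R]_4) (a : 'I_4) (t : R) : 'rV[R]_4 :=
  \row_c if c == a then t else x 0 c.

Lemma updE x a t : upd x a t = x + (t - x 0 a) *: delta_mx 0 a.
Proof.
apply/rowP => c; rewrite !mxE eqxx/=; have [->|_] := eqVneq c a; first by rewrite mulr1 addrC subrK.
by rewrite mulr0 addr0.
Qed.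

Lemma upd_id x a : upd x a (x 0 a) = x.
Proof. by apply/rowP => c; rewrite mxE; case: eqVneq => [->|]. Qed.

Lemma upd_upd x a s t : upd (upd x a s) a t = upd x a t.
Proof. by apply/rowP => c; rewrite !mxE; case: eqVneq. Qed.

Lemma updC x a b s t : a != b ->
  upd (upd x a s) b t = upd (upd x b t) a s.
Proof.
move=> ab; apply/rowP => c; rewrite !mxE.
by case: (eqVneq c b) => [->|//]; rewrite eq_sym (negbTE ab).
Qed.

Lemma upd_val x a t : upd x a t 0 a = t.
Proof. by rewrite mxE eqxx. Qed.

Definition int1 (a : 'I_4) f x : R := (\int[mu]_t f (upd x a t))%R.

(** Continuity is along coordinate lines only, which dominated convergence carries through an
    integration. [S] holds the variables not yet integrated: integrating one makes the function
    constant in it, so its support is no longer bounded in that direction. *)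
Definition box_bounded S (N M : R) f :=
  [/\ forall x a, continuous (fun t => f (upd x a t)),
      forall x, `|f x| <= M
    & forall x a, a \in S -> N < `|x 0 a| -> f x = 0].

Lemma box_bounded_slice0 S N M f a x t :
  box_bounded S N M f -> a \in S -> N < `|t| -> f (upd x a t) = 0.
Proof. by move=> [_ _ f0] aS tN; apply: (f0 _ a) => //; rewrite upd_val. Qed.

Lemma box_bounded_le S N M N' M' f : N <= N' -> M <= M' ->
  box_bounded S N M f -> box_bounded S N' M' f.
Proof.
move=> NN MM [c b z]; split=> //.
  by move=> x; exact: le_trans (b x) MM.
by move=> x a aS xN; apply: (z x a) => //; exact: le_lt_trans NN xN.
Qed.

Lemma int1_integrable S N M f a x : box_bounded S N M f -> a \in S ->
  mu.-integrable setT (EFin \o (fun t => f (upd x a t))).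
Proof.
move=> bf aS; apply: (continuous_supp_integrable _ N); first by case: bf.
by move=> t; exact: box_bounded_slice0 bf aS.
Qed.

Lemma int1D S N M M' f k a : box_bounded S N M f -> box_bounded S N M' k ->
  a \in S -> int1 a (f \+ k) = int1 a f \+ int1 a k.
Proof.
move=> bf bk aS; apply/funext => x; rewrite /int1 /=.
by rewrite -RintegralD//; [exact: int1_integrable bf aS|exact: int1_integrable bk aS].
Qed.

Lemma int1Z S N M f r a : box_bounded S N M f -> a \in S ->
  int1 a (r \*o f) = r \*o int1 a f.
Proof.
move=> bf aS; apply/funext => x; rewrite /int1 /=.
by rewrite -RintegralZl//; exact: int1_integrable bf aS.
Qed.

Lemma int1_box_bounded S N M f a : 0 < N -> box_bounded S N M f -> a \in S ->
  box_bounded (S :\ a) N (M * (N + N)) (int1 a f).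
Proof.
move=> N0 bf aS; have [c b z] := bf; split=> [x d|x|x d].
(* Along the direction just integrated the result is constant. *)
- rewrite /int1; have [<-|ad] := eqVneq a d.
    by under eq_fun do under eq_fun do rewrite upd_upd; move=> t; exact: cvg_cst.
  apply: (@continuous_parameter_Rintegral R
    (fun s t => f (upd (upd x d s) a t)) N M) => //.
  + move=> t; rewrite (_ : (fun s => f (upd (upd x d s) a t)) = fun s => f (upd (upd x a t) d s)).
      exact: c.
    by apply/funext => s; rewrite updC 1?eq_sym.
  + by move=> s t tN; exact: box_bounded_slice0 bf aS tN.
- apply: Rintegral_supp_bound => //.
  by move=> t; exact: box_bounded_slice0 bf aS.
- rewrite inE => /andP[]; rewrite inE => da dS xN.
  rewrite /int1 (_ : (fun t => _) = (fun=> 0)) ?Rintegral_cst ?mul0r//.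
  by apply/funext => t; apply: (z _ d) => //; rewrite mxE (negbTE da).
Qed.

Definition slice_derive b f k :=
  forall x (t : R), is_derive t 1 (fun s => f (upd x b s)) (k (upd x b t)).

(** Differentiation under the integral sign, dominated by the bound [M] of [k]. *)
Lemma int1_slice_derive S N M f k a b : 0 < N -> box_bounded S N M f ->
  box_bounded S N M k -> a \in S -> a != b ->
  slice_derive b f k -> slice_derive b (int1 a f) (int1 a k).
Proof.
move=> N0 bf bk aS ab dfk x t; rewrite /int1.
have [c _ _] := bf; have [c' b' _] := bk.
apply: (@derive_parameter_Rintegral R
  (fun s u => f (upd (upd x b s) a u)) (fun s u => k (upd (upd x b s) a u))
  N M) => //.
- by move=> s u uN; exact: box_bounded_slice0 bf aS uN.
- by move=> s u uN; exact: box_bounded_slice0 bk aS uN.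
- move=> s u; rewrite (_ : (fun s => f (upd (upd x b s) a u)) = fun s => f (upd (upd x a u) b s)).
    by rewrite updC 1?eq_sym//; exact: dfk.
  by apply/funext => s'; rewrite updC 1?eq_sym.
Qed.

Lemma int1_derive0 S N M f k b : 0 < N -> box_bounded S N M f ->
  box_bounded S N M k -> b \in S -> slice_derive b f k -> int1 b k = cst 0.
Proof.
move=> N0 bf bk bS dfk; apply/funext => x; rewrite /int1.
apply: (@Rintegral_derive0 R (fun t => f (upd x b t)) _ N) => //.
- by case: bk.
- by move=> t; exact: box_bounded_slice0 bf bS.
- by move=> t; exact: box_bounded_slice0 bk bS.
Qed.

Lemma int1_0 a : int1 a (cst 0) = cst 0.
Proof. by apply/funext => x; rewrite /int1 Rintegral_cst ?mul0r. Qed.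

Lemma int1_ge0 a f : (forall x, 0 <= f x) -> forall x, 0 <= int1 a f x.
Proof. by move=> f0 x; apply: Rintegral_ge0. Qed.

Lemma int1_gt0 S N M f a x : box_bounded S N M f -> a \in S ->
  (forall x, 0 <= f x) -> 0 < f x -> 0 < int1 a f x.
Proof.
move=> bf aS f0 fx; apply: (Rintegral_gt0 _ N (x 0 a)) => //.
- by case: bf.
- by move=> t; exact: box_bounded_slice0 bf aS.
- by rewrite upd_id.
Qed.

(** Kept as a function of the point, although constant ([int4_const]), so that the lemmas on [int1]
    compose. *)
Definition int4 f : 'rV[R]_4 -> R :=
  int1 (inord 0) (int1 (inord 1) (int1 (inord 2) (int1 (inord 3) f))).

Lemma ord4_neq (i j : nat) : (i < 4)%N -> (j < 4)%N ->
  ((inord i : 'I_4) == inord j) = (i == j).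
Proof. by move=> i4 j4; rewrite -val_eqE/= !inordK. Qed.

Lemma integral_onE (U : set 'rV[R]_4) f :
  integral_on U f = int4 (f \_ U) 0.
Proof.
rewrite /integral_on /int4 /int1.
apply: eq_Rintegral => x0 _; apply: eq_Rintegral => x1 _.
apply: eq_Rintegral => x2 _; apply: eq_Rintegral => x3 _.
congr (_ _); apply/rowP => c; rewrite !mxE.
by case: c => [[|[|[|[|//]]]] c4] /=; rewrite -!val_eqE/= !inordK.
Qed.

Notation S3 := [set: 'I_4]%SET.
Notation S2 := (S3 :\ inord 3)%SET.
Notation S1 := (S2 :\ inord 2)%SET.
Notation S0 := (S1 :\ inord 1)%SET.

Let in3 : (inord 3 : 'I_4) \in S3. Proof. by rewrite inE. Qed.
Let in2 : (inord 2 : 'I_4) \in S2. Proof. by rewrite !inE !ord4_neq. Qed.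
Let in1 : (inord 1 : 'I_4) \in S1. Proof. by rewrite !inE !ord4_neq. Qed.
Let in0 : (inord 0 : 'I_4) \in S0. Proof. by rewrite !inE !ord4_neq. Qed.

Lemma int4_chain N M f : 0 < N -> box_bounded S3 N M f ->
  [/\ box_bounded S2 N (M * (N + N)) (int1 (inord 3) f),
      box_bounded S1 N (M * (N + N) * (N + N))
        (int1 (inord 2) (int1 (inord 3) f))
    & box_bounded S0 N (M * (N + N) * (N + N) * (N + N))
        (int1 (inord 1) (int1 (inord 2) (int1 (inord 3) f)))].
Proof.
move=> N0 b3; have b2 := int1_box_bounded _ _ _ _ _ N0 b3 in3.
have b1 := int1_box_bounded _ _ _ _ _ N0 b2 in2.
by have b0 := int1_box_bounded _ _ _ _ _ N0 b1 in1.
Qed.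

Lemma int4D N M M' f k : 0 < N -> box_bounded S3 N M f ->
  box_bounded S3 N M' k -> int4 (f \+ k) = int4 f \+ int4 k.
Proof.
move=> N0 bf bk; rewrite /int4.
have [bf2 bf1 bf0] := int4_chain _ _ _ N0 bf.
have [bk2 bk1 bk0] := int4_chain _ _ _ N0 bk.
rewrite (int1D _ _ _ _ _ _ _ bf bk)// (int1D _ _ _ _ _ _ _ bf2 bk2)//.
by rewrite (int1D _ _ _ _ _ _ _ bf1 bk1)// (int1D _ _ _ _ _ _ _ bf0 bk0).
Qed.

Lemma int4Z N M f r : 0 < N -> box_bounded S3 N M f ->
  int4 (r \*o f) = r \*o int4 f.
Proof.
move=> N0 bf; rewrite /int4; have [bf2 bf1 bf0] := int4_chain _ _ _ N0 bf.
rewrite (int1Z _ _ _ _ _ _ bf)// (int1Z _ _ _ _ _ _ bf2)//.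
by rewrite (int1Z _ _ _ _ _ _ bf1)// (int1Z _ _ _ _ _ _ bf0).
Qed.

Lemma int4_gt0 N M f x : 0 < N -> box_bounded S3 N M f ->
  (forall x, 0 <= f x) -> 0 < f x -> 0 < int4 f x.
Proof.
move=> N0 bf f0 fx; rewrite /int4; have [bf2 bf1 bf0] := int4_chain _ _ _ N0 bf.
do 3 ?[apply: int1_gt0; [by eassumption|by []|by do ?apply: int1_ge0|]].
exact: (int1_gt0 _ _ _ _ _ _ bf).
Qed.

Lemma int4_const f x y : int4 f x = int4 f y.
Proof.
rewrite /int4 /int1; apply: eq_Rintegral => x0 _; apply: eq_Rintegral => x1 _.
apply: eq_Rintegral => x2 _; apply: eq_Rintegral => x3 _; congr (_ _); apply/rowP => c; rewrite !mxE.
by case: c => [[|[|[|[|//]]]] c4] /=; rewrite -!val_eqE/= !inordK.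
Qed.

Lemma int4_derive0 N M f k b : 0 < N -> box_bounded S3 N M f ->
  box_bounded S3 N M k -> slice_derive b f k -> int4 k = cst 0.
Proof.
move=> N0 bf bk d3.
have [bf2 bf1 bf0] := int4_chain _ _ _ N0 bf.
have [bk2 bk1 bk0] := int4_chain _ _ _ N0 bk.
rewrite /int4.
have [b3|b3] := eqVneq (inord 3) b.
  subst b; rewrite (int1_derive0 _ _ _ _ _ _ N0 bf bk)//.
  by rewrite !int1_0.
have d2 := int1_slice_derive _ _ _ _ _ _ _ N0 bf bk in3 b3 d3.
have [b2|b2] := eqVneq (inord 2) b.
  subst b; rewrite (int1_derive0 _ _ _ _ _ _ N0 bf2 bk2)//.
  by rewrite !int1_0.
have d1 := int1_slice_derive _ _ _ _ _ _ _ N0 bf2 bk2 in2 b2 d2.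
have [b1|b1] := eqVneq (inord 1) b.
  subst b; rewrite (int1_derive0 _ _ _ _ _ _ N0 bf1 bk1)//.
  by rewrite !int1_0.
have d0 := int1_slice_derive _ _ _ _ _ _ _ N0 bf1 bk1 in1 b1 d1.
(* None of the three inner variables is [b], so it is the outermost one. *)
have -> : (inord 0 : 'I_4) = b.
  move: b3 b2 b1; rewrite -!val_eqE /= !inordK// => b3 b2 b1.
  apply/val_inj; rewrite /= inordK//.
  by case: b b3 b2 b1 {d3 d2 d1 d0} => [[|[|[|[|//]]]] ?].
apply: (int1_derive0 _ _ _ _ _ _ N0 bf0 bk0) => //.
move: b3 b2 b1; rewrite !inE -!val_eqE /= !inordK// => b3 b2 b1.
by rewrite eq_sym b1 eq_sym b2 eq_sym b3.
Qed.

End IteratedIntegral.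

(** * Zero extension of functions supported in a compact subset of U *)

Lemma near_eq_continuous_at {R : realType} (T : topologicalType) (f g : T -> R)
  (x : T) : (\forall y \near x, g y = f y) -> {for x, continuous f} ->
  {for x, continuous g}.
Proof.
move=> gf cf; have /= gfx := nbhs_singleton gf; change (g @ x --> g x); rewrite gfx.
by apply: cvg_trans cf; apply: near_eq_cvg; apply: filterS gf => y ->.
Qed.

Section CompactSupport.
Context {R : realType} (U K : set 'rV[R]_4).
Hypotheses (oU : open U) (cK : compact K) (KU : K `<=` U).
Implicit Types (f W : 'rV[R]_4 -> R) (x y : 'rV[R]_4).

Lemma near_open x : U x -> \forall y \near x, U y.
Proof. by move=> Ux; apply: open_nbhs_nbhs. Qed.

Lemma closed_supp : closed K.
Proof. by apply: compact_closed => //; exact: norm_hausdorff. Qed.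

Lemma near_off_supp x : ~ K x -> \forall y \near x, ~ K y.
Proof.
move=> nKx; apply: (@open_nbhs_nbhs _ x (~` K)); split => //.
by rewrite openC; exact: closed_supp.
Qed.

Lemma patch_in f x : U x -> (f \_ U) x = f x.
Proof. by move=> Ux; rewrite patchE mem_set. Qed.

Lemma patch_out f x : ~ U x -> (f \_ U) x = 0.
Proof. by move=> Ux; rewrite patchE memNset. Qed.

(** Nothing is asked outside [U], where the values of a field are irrelevant and the zero extension
    overrides them. *)
Definition supported f := forall x, U x -> ~ K x -> f x = 0.

Lemma supported_patch0 f x : supported f -> ~ K x -> (f \_ U) x = 0.
Proof.
move=> f0 nK; have [Ux|nU] := pselect (U x); last exact: patch_out.
by rewrite patch_in// f0.
Qed.

Lemma near_patch0 f x : supported f -> ~ U x ->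
  \forall y \near x, (f \_ U) y = 0.
Proof.
move=> f0 nU; have : ~ K x by move=> /KU.
by move=> /near_off_supp; apply: filterS => y; exact: supported_patch0.
Qed.

Lemma near_patch f x : U x -> \forall y \near x, (f \_ U) y = f y.
Proof. by move=> /near_open; apply: filterS => y; exact: patch_in. Qed.

(** A point outside [U] lies outside the closed set [K], so a whole neighbourhood misses [K], and
    there the extension is identically zero. *)
Lemma patch_continuous f : supported f ->
  (forall x, U x -> {for x, continuous f}) -> continuous (f \_ U).
Proof.
move=> f0 cf x; have [Ux|nU] := pselect (U x).
  exact: near_eq_continuous_at (near_patch f x Ux) (cf x Ux).
apply: (near_eq_continuous_at _ (cst 0) _ x (near_patch0 f x f0 nU)).
exact: (@cst_continuous _ _ (0 : R)).
Qed.

Lemma patch_bounded f : supported f ->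
  (forall x, U x -> {for x, continuous f}) ->
  exists M, forall x, `|(f \_ U) x| <= M.
Proof.
move=> f0 cf; have cg := patch_continuous f f0 cf.
have /compact_bounded[M [_ HM]] : compact ((f \_ U) @` K).
  by apply: continuous_compact => //; exact: continuous_subspaceT.
exists (`|M| + 1) => x; have [Kx|nKx] := pselect (K x).
  by apply: (HM (`|M| + 1)) => /=; [rewrite (le_lt_trans (ler_norm _))// ltrDl | exists x].
by rewrite supported_patch0// normr0 addr_ge0.
Qed.

Lemma compact_box : exists2 N : R, 0 < N & forall x a, K x -> `|x 0 a| <= N.
Proof.
have /compact_bounded[M [_ HM]] := cK.
exists (`|M| + 1); first by rewrite ltr_wpDl.
move=> x a Kx; apply: (@le_trans _ _ `|x|).
  by rewrite [leRHS](mx_normrE x) (le_bigmax_cond _ (fun i => `|x i.1 i.2|) (j := (0, a))).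
by apply: HM => //; rewrite (le_lt_trans (ler_norm _))// ltrDl.
Qed.

Lemma upd_line x b : upd x b = (fun t : R => (x - x 0 b *: delta_mx 0 b) + t *: delta_mx 0 b).
Proof.
by apply/funext => t; rewrite updE scalerBl addrAC addrA.
Qed.

Lemma upd_continuous x b : continuous (upd x b).
Proof.
rewrite upd_line => t; apply: cvgD; first exact: cvg_cst.
exact: scalel_continuous.
Qed.

Lemma upd_is_diff x b (t : R) :
  is_diff t (upd x b) (fun h : R => h *: delta_mx 0 b).
Proof.
rewrite upd_line; apply: is_diff_eq.
by rewrite add0r.
Qed.

Lemma patch_box_bounded f N : supported f ->
  (forall x, U x -> {for x, continuous f}) ->
  (forall x a, K x -> `|x 0 a| <= N) ->
  exists M, box_bounded [set: 'I_4]%SET N M (f \_ U).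
Proof.
move=> f0 cf KN; have [M HM] := patch_bounded f f0 cf.
exists M; split => // [x a t|x a _ xN].
  by apply: continuous_comp; [exact: upd_continuous|exact: patch_continuous].
apply: supported_patch0 => // Kx.
by move: (KN x a Kx); rewrite leNgt xN.
Qed.

Lemma patch_slice_derive W b : supported W ->
  (forall x, U x -> differentiable W x) ->
  slice_derive b (W \_ U) (partial b W \_ U).
Proof.
move=> W0 dW x t; set y := upd x b t.
have pull (P : set 'rV[R]_4) : (\forall z \near y, P z) ->
    \forall s \near t, P (upd x b s).
  by move=> Py; exact: (upd_continuous x b t).
have [Uy|nUy] := pselect (U y).
  rewrite patch_in//.
  apply: (@near_eq_is_derive _ _ _ (fun s => W (upd x b s))).
    by apply: (pull [set z | W z = (W \_ U) z]); apply: filterS (near_patch W y Uy) => z /= ->.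
  have dWy := dW y Uy.
  have du := upd_is_diff x b t.
  have dc : differentiable (W \o upd x b) t.
    by apply: differentiable_comp => //; exact: ex_diff.
  apply: DeriveDef; first exact: diff_derivable.
  rewrite deriveE// diff_comp//=.
  by rewrite diff_val scale1r /partial deriveE.
rewrite patch_out//.
apply: (@near_eq_is_derive _ _ _ (cst (0 : R))).
by apply: (pull [set z | 0 = (W \_ U) z]); apply: filterS (near_patch0 W y W0 nUy) => z /= ->.
Qed.

Lemma partial_supported W a : (forall x, ~ K x -> W x = 0) ->
  forall x, ~ K x -> partial a W x = 0.
Proof.
move=> W0 x nK; rewrite /partial.
rewrite (@near_eq_derive _ _ _ W (cst 0)) ?derive_cst//.
by apply: filterS (near_off_supp x nK) => z /W0.
Qed.

End CompactSupport.

(** * Smooth bump functions *)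

Section SmoothBump.
Context {R : realType}.

(** The powers of 1/t make the family closed under differentiation up to linear combinations
    ([flat_is_derive]), so a single first-derivative computation yields smoothness. *)
Definition flat (n : nat) (t : R) : R :=
  if 0 < t then expR (- t^-1) * t^-1 ^+ n else 0.

Lemma flat_ge0 n t : 0 <= flat n t.
Proof.
rewrite /flat; case: ifPn => // t0.
by rewrite mulr_ge0 ?expR_ge0// exprn_ge0// invr_ge0 ltW.
Qed.

Lemma flat_gt0 n t : 0 < t -> 0 < flat n t.
Proof.
by move=> t0; rewrite /flat t0 mulr_gt0 ?expR_gt0// exprn_gt0// invr_gt0.
Qed.

Lemma flat_le0 n t : t <= 0 -> flat n t = 0.
Proof. by rewrite /flat leNgt => /negbTE ->. Qed.

(** With u = 1/t, exp u is bounded below by the single term of degree n + 1 of its series. *)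
Lemma flat_le n t : flat n.+1 t <= n.+1`!%:R.
Proof.
rewrite /flat; case: ifPn => [t0|_]; last exact: ler0n.
have u0 : 0 <= t^-1 by rewrite invr_ge0 ltW.
rewrite expRN mulrC ler_pdivrMr ?expR_gt0//.
have F0 : 0 < n.+1`!%:R :> R by rewrite ltr0n fact_gt0.
rewrite mulrC -ler_pdivrMr//.
by apply: le_trans (expR_ge1Dxn n u0); rewrite lerDr.
Qed.

Lemma flatS n t : flat n t = flat n.+1 t * t.
Proof.
rewrite /flat; case: ifPn => [t0|]; last by rewrite mul0r.
by rewrite exprSr mulrA mulfVK// gt_eqF.
Qed.

Lemma flat_is_derive n (t : R) :
  is_derive t 1 (flat n) (flat n.+2 t - n%:R * flat n.+1 t).
Proof.
have [t0|t0|->] := ltgtP t 0.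
- rewrite !flat_le0 ?ltW// mulr0 subr0.
  apply: (@near_eq_is_derive _ _ _ (cst (0 : R))).
  by near=> s; rewrite flat_le0// ltW//; near: s; exact: lt_nbhsl.
- have tn0 : t != 0 by rewrite gt_eqF.
  apply: (@near_eq_is_derive _ _ _ (fun s : R => (expR (- s^-1) * s^-1 ^+ n : R))).
    near=> s; rewrite /flat ifT//; near: s; exact: lt_nbhsr.
  have dV : is_derive t 1 (fun s : R => s^-1) (- t^-1 ^+ 2).
    apply: DeriveDef; first exact: derivableV.
    by rewrite deriveV// derive_id -exprVn [_ *: _]mulr1.
  have dN : is_derive t 1 (fun s : R => - s^-1) (t^-1 ^+ 2).
    by rewrite -[t^-1 ^+ 2]opprK; exact: is_deriveN.
  have dE : is_derive t 1 (fun s : R => expR (- s^-1)) (expR (- t^-1) * t^-1 ^+ 2).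
    exact: (is_derive1_comp (is_derive_expR _)).
  have dX := is_deriveX n dV.
  have dM := is_deriveM dE dX.
  rewrite (_ : (fun s : R => _) =
    (fun s : R => expR (- s^-1)) * (fun s : R => s^-1) ^+ n); last first.
    by apply/funext => s; rewrite !fctE.
  apply: is_derive_eq.
  rewrite /flat t0 !fctE /=; set u := t^-1; set e := expR _.
  rewrite -![_ *: _]/(_ * _).
  (* [is_deriveX] produces the exponent [n.-1], hence the separate case n = 0. *)
  by case: n {dX dM} => [|m] /=; rewrite ?mul0r ?exprS; ring.
- (* the slope [flat n.+1] is continuous at 0 because it is
     [t * flat n.+2 t], with a bounded second factor *)
  rewrite !flat_le0// mulr0 subr0; apply/is_derive1_caratheodory.
  exists (flat n.+1); split; last by rewrite flat_le0.
    by move=> z; rewrite (flat_le0 _ 0)// !subr0 flatS.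
  change (flat n.+1 s @[s --> (0 : R)] --> flat n.+1 0); rewrite flat_le0//.
  have c0 : (fun s : R => n.+2`!%:R * `|s|) @ (0 : R) --> (0 : R).
    have nc : (fun s : R => `|s|) @ (0 : R) --> `|0 : R| by exact: norm_continuous.
    have cc : (fun _ : R => n.+2`!%:R : R) @ (0 : R) --> (n.+2`!%:R : R) by exact: cvg_cst.
    by have h := cvgM cc nc; rewrite normr0 mulr0 in h; exact: h.
  apply: (@squeeze_cvgr _ _ _ _ (fun s => - (n.+2`!%:R * `|s|)) (fun s : R => n.+2`!%:R * `|s|)).
  + near=> s; rewrite -ler_norml flatS normrM ger0_norm ?flat_ge0//.
    by rewrite ler_wpM2r// flat_le.
  + by have h := cvgN c0; rewrite oppr0 in h; exact: h.
  + exact: c0.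
Unshelve. all: by end_near. Qed.

(** A class that contains the bump functions and is closed under [partial], so that induction on the
    list of derivatives in [smooth] applies. *)
Inductive bump_algebra : ('rV[R]_4 -> R) -> Prop :=
| bump_cst c : bump_algebra (cst c)
| bump_flat n (a : 'I_4) (s c : R) :
    bump_algebra (fun x => flat n (s * x 0 a + c))
| bump_add f k : bump_algebra f -> bump_algebra k -> bump_algebra (f + k)
| bump_mul f k : bump_algebra f -> bump_algebra k -> bump_algebra (f * k).

Lemma coord_is_diff (x : 'rV[R]_4) (a : 'I_4) :
  is_diff x (fun y : 'rV[R]_4 => y 0 a : R) (fun v => v 0 a).
Proof.
(* Packaged as a continuous linear map, the coordinate is its own differential. *)
have @f : {linear 'rV[R]_4 -> R}.
  by exists (fun N : 'rV[R]_4 => N 0 a); do 2![eexists]; do ?[constructor];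
     rewrite ?mxE// => ? *; rewrite ?mxE//; move=> ?; rewrite !mxE.
have fc : continuous f by exact: coord_continuous.
by apply: DiffDef; [exact: differentiable_coord | exact: (diff_lin x fc)].
Qed.

Lemma is_derive_comp1 (g : 'rV[R]_4 -> R) (F : R -> R) x v (dF : R) :
  differentiable g x -> is_derive (g x) 1 F dF ->
  is_derive x v (F \o g) ('D_v g x * dF).
Proof.
move=> dg [dFx <-]; have /derivable1_diffP dFx' := dFx.
have dc : differentiable (F \o g) x by exact: differentiable_comp.
apply: DeriveDef; first exact: diff_derivable.
rewrite !deriveE// diff_comp//=.
by rewrite -[X in 'd _ _ X = _]mulr1 [LHS]linearZ.
Qed.

Lemma affineE (a : 'I_4) (s c : R) :
  (fun y : 'rV[R]_4 => s * y 0 a + c) =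
  s *: (fun y : 'rV[R]_4 => y 0 a : R) + cst c.
Proof. by apply/funext => y; rewrite !fctE. Qed.

Lemma affine_differentiable (a : 'I_4) (s c : R) (x : 'rV[R]_4) :
  differentiable (fun y : 'rV[R]_4 => s * y 0 a + c : R) x.
Proof.
rewrite affineE; apply: differentiableD; last exact: differentiable_cst.
by apply: differentiableZ; exact: differentiable_coord.
Qed.

Lemma affine_partial (a b : 'I_4) (s c : R) (x : 'rV[R]_4) :
  'D_(delta_mx 0 b) (fun y : 'rV[R]_4 => s * y 0 a + c : R) x = s * (a == b)%:R.
Proof.
have dc := coord_is_diff x a.
have dcoord : is_derive x (delta_mx 0 b) (fun y : 'rV[R]_4 => y 0 a : R) (a == b)%:R.
  apply: DeriveDef; first exact/diff_derivable/differentiable_coord.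
  by rewrite deriveE ?diff_val ?mxE//; exact: differentiable_coord.
by rewrite affineE derive_val addr0.
Qed.

Lemma bump_differentiable f x : bump_algebra f -> differentiable f x.
Proof.
elim=> [c|n a s c|f' k' _ df _ dk|f' k' _ df _ dk].
- exact: differentiable_cst.
- apply: differentiable_comp; first exact: affine_differentiable.
  by apply/derivable1_diffP; have := flat_is_derive n (s * x 0 a + c) => -[].
- exact: differentiableD.
- exact: differentiableM.
Qed.

Lemma bump_partial f b : bump_algebra f -> bump_algebra (partial b f).
Proof.
elim=> [c|n a s c|f' k' hf df hk dk|f' k' hf df hk dk].
- rewrite (_ : partial b _ = cst 0); first exact: bump_cst.
  by apply/funext => x; rewrite /partial derive_cst.
- rewrite (_ : partial b _ = cst (s * (a == b)%:R) *
    ((fun x => flat n.+2 (s * x 0 a + c)) +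
     cst (- n%:R) * (fun x => flat n.+1 (s * x 0 a + c)))).
    by do ?[exact: bump_cst | exact: bump_flat | apply: bump_add | apply: bump_mul].
  apply/funext => x; rewrite /partial.
  have /= := is_derive_comp1 _ _ x (delta_mx 0 b) _ (affine_differentiable a s c x)
      (flat_is_derive n (s * x 0 a + c)).
  move=> dd; rewrite derive_val affine_partial.
  by rewrite !fctE mulNr.
- rewrite (_ : partial b _ = partial b f' + partial b k'); first exact: bump_add.
  apply/funext => x; rewrite /partial deriveD//;
    by apply: diff_derivable; exact: bump_differentiable.
- rewrite (_ : partial b _ = f' * partial b k' + k' * partial b f').
    by apply: bump_add; exact: bump_mul.
  apply/funext => x; rewrite /partial deriveM//;
    by apply: diff_derivable; exact: bump_differentiable.
Qed.

Lemma bump_smooth U f : bump_algebra f -> smooth U f.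
Proof.
move=> bf s x _; apply: bump_differentiable.
by elim: s => //= b s; exact: bump_partial.
Qed.

(** Positive exactly on the open cube of half-side [r] about [p]: each pair of opposite faces
    contributes two factors, one for either face. *)
Definition bump_fun (p : 'rV[R]_4) (r : R) (x : 'rV[R]_4) : R :=
  \prod_(a < 4) (flat 0 (x 0 a - (p 0 a - r)) * flat 0 (p 0 a + r - x 0 a)).

Lemma bump_in_algebra p r : bump_algebra (bump_fun p r).
Proof.
rewrite /bump_fun (_ : (fun _ => _) = \prod_(a < 4)
  ((fun x : 'rV[R]_4 => flat 0 (1 * x 0 a + (- (p 0 a - r)))) *
   (fun x : 'rV[R]_4 => flat 0 (-1 * x 0 a + (p 0 a + r))))).
  elim/big_ind : _ => [|f k|a _]; [exact: bump_cst|exact: bump_mul|].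
  by apply: bump_mul; exact: bump_flat.
apply/funext => x; rewrite fct_prodE; apply: eq_bigr => a _ /=.
by rewrite !fctE mul1r mulN1r [in RHS](addrC (- x 0 a)).
Qed.

Lemma bump_ge0 p r x : 0 <= bump_fun p r x.
Proof. by apply: prodr_ge0 => a _; rewrite mulr_ge0 ?flat_ge0. Qed.

Lemma bump_gt0 p r : 0 < r -> 0 < bump_fun p r p.
Proof.
move=> r0; apply: prodr_gt0 => a _; rewrite mulr_gt0 ?flat_gt0//; lra.
Qed.

Lemma bump_eq0 (p : 'rV[R]_4) r (x : 'rV[R]_4) a : r < `|x 0 a - p 0 a| -> bump_fun p r x = 0.
Proof.
move=> rx; rewrite /bump_fun (bigD1 a)//=.
have [h|h] := leP 0 (x 0 a - p 0 a).
  by rewrite (flat_le0 _ (p 0 a + r - _)) ?mulr0 ?mul0r//; move: rx; rewrite ger0_norm//; lra.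
by rewrite (flat_le0 _ (x 0 a - _)) ?mulr0 ?mul0r//; move: rx; rewrite ltr0_norm//; lra.
Qed.

End SmoothBump.

(** * Exterior algebra in dimension four *)

Section ExteriorAlgebra.
Context {R : comPzRingType}.
Implicit Types (u v w z : 'I_4 -> R) (t : 'I_4 -> 'I_4 -> R).

Notation i0 := (inord 0 : 'I_4).
Notation i1 := (inord 1 : 'I_4).
Notation i2 := (inord 2 : 'I_4).
Notation i3 := (inord 3 : 'I_4).

Lemma sum4 (F : 'I_4 -> R) : \sum_i F i = F i0 + F i1 + F i2 + F i3.
Proof.
rewrite !big_ord_recl big_ord0 addr0 !addrA.
by congr (F _ + F _ + F _ + F _); apply/val_inj; rewrite /= inordK.
Qed.

(* The components of u /\ v /\ w. *)
Definition tri u v w (a b c : 'I_4) : R :=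
  u a * (v b * w c - v c * w b) + u b * (v c * w a - v a * w c)
  + u c * (v a * w b - v b * w a).

(* The 0123-component of u /\ v /\ t, for a 2-form t. *)
Definition quad u v t : R :=
  u i0 * (v i1 * t i2 i3 + v i2 * t i3 i1 + v i3 * t i1 i2)
  - u i1 * (v i0 * t i2 i3 + v i2 * t i3 i0 + v i3 * t i0 i2)
  + u i2 * (v i0 * t i1 i3 + v i1 * t i3 i0 + v i3 * t i0 i1)
  - u i3 * (v i0 * t i1 i2 + v i1 * t i2 i0 + v i2 * t i0 i1).

(* The 0123-component of z /\ u /\ v /\ w. *)
Definition vol4 z u v w : R :=
  z i0 * tri u v w i1 i2 i3 - z i1 * tri u v w i0 i2 i3
  + z i2 * tri u v w i0 i1 i3 - z i3 * tri u v w i0 i1 i2.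

(** [D a b] stands for the derivative of the b-th component in direction a, but is a free array:
    identities of exterior calculus thus become polynomial identities for [ring]. *)
Definition dform (D : 'I_4 -> 'I_4 -> R) (a b : 'I_4) : R := D a b - D b a.

Lemma quad_expand u u' v v' t t' (e : R) :
  quad (fun a => u a + e * u' a) (fun a => v a + e * v' a)
    (fun a b => t a b + e * t' a b) =
  quad u v t + e * (quad u' v t + quad u v' t + quad u v t')
  + e ^+ 2 * (quad u' v' t + quad u' v t' + quad u v' t')
  + e ^+ 3 * quad u' v' t'.
Proof. rewrite /quad; ring. Qed.

Lemma quadDl u u' v t : quad (fun a => u a + u' a) v t = quad u v t + quad u' v t.
Proof. rewrite /quad; ring. Qed.

Lemma quad_suml (c : 'I_4 -> R) (p : 'I_4 -> 'I_4 -> R) v t :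
  quad (fun a => \sum_k c k * p k a) v t = \sum_k c k * quad (p k) v t.
Proof. rewrite /quad !sum4; ring. Qed.

Lemma quad_sumr (c : 'I_4 -> R) (p : 'I_4 -> 'I_4 -> R) u t :
  quad u (fun a => \sum_k c k * p k a) t = \sum_k c k * quad u (p k) t.
Proof. rewrite /quad !sum4; ring. Qed.

(** The Leibniz rule d(c p) = dc /\ p + c dp at the level of free arrays. *)
Lemma quad_dform_sum u v (c : 'I_4 -> R) (p : 'I_4 -> 'I_4 -> R)
    (dc : 'I_4 -> 'I_4 -> R) (dp : 'I_4 -> 'I_4 -> 'I_4 -> R) :
  quad u v (dform (fun a b => \sum_k (dc a k * p k b + c k * dp a k b))) =
  \sum_k (vol4 u v (dc^~ k) (p k) + c k * quad u v (dform (fun a => dp a k))).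
Proof.
transitivity (\sum_k quad u v (fun a b => (dc a k * p k b - dc b k * p k a)
     + c k * dform (fun a => dp a k) a b)).
  rewrite /quad /dform !sum4; ring.
by apply: eq_bigr => k _; rewrite /quad /vol4 /tri /dform; ring.
Qed.

Lemma vol4_rot z u v w : vol4 u v z w = vol4 z u v w.
Proof. rewrite /vol4 /tri; ring. Qed.

(* The 0123-component of d(u /\ v /\ w). *)
Lemma tri_divergence u v w (du dv dw : 'I_4 -> 'I_4 -> R) :
  let D c a b d := tri (du c) v w a b d + tri u (dv c) w a b d
                   + tri u v (dw c) a b d in
  D i0 i1 i2 i3 - D i1 i0 i2 i3 + D i2 i0 i1 i3 - D i3 i0 i1 i2 =
  quad v w (dform du) - quad u w (dform dv) + quad u v (dform dw).
Proof. rewrite /= /tri /quad /dform; ring. Qed.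

(** [quad] reads both the 13 and the 31 entry of its 2-form, so exchanging u and v relies on the
    antisymmetry of [dform D]. *)
Lemma quadC (u v : 'I_4 -> R) (D : 'I_4 -> 'I_4 -> R) : quad v u (dform D) = - quad u v (dform D).
Proof. rewrite /quad /dform; ring. Qed.

Lemma quad_same (u : 'I_4 -> R) (D : 'I_4 -> 'I_4 -> R) : quad u u (dform D) = 0.
Proof. rewrite /quad /dform; ring. Qed.

Section FirstVariation.
Variables (s : 'I_4 -> R) (p : 'I_4 -> 'I_4 -> R) (D : 'I_4 -> 'I_4 -> 'I_4 -> R).
Variables (F : 'I_4 -> 'I_4 -> R) (dF : 'I_4 -> 'I_4 -> 'I_4 -> R).

Definition lvec (q : 'I_4 -> 'I_4 -> R) (a : 'I_4) : R := q i0 a + q i3 a.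
Definition rotated (q : 'I_4 -> 'I_4 -> R) (j a : 'I_4) : R := \sum_k F j k * q k a.
Definition drotated (c j a : 'I_4) : R :=
  \sum_k (dF c j k * p k a + F j k * D c k a).

(* Three times the Lagrangian, polarised in the coframe entering l, the coframe
   entering the axial torsion, and the derivatives of the latter. *)
Definition lag3 (q r : 'I_4 -> 'I_4 -> R) (G : 'I_4 -> 'I_4 -> 'I_4 -> R) : R :=
  \sum_j s j * quad (lvec q) (r j) (dform (fun a => G a j)).

Lemma lag3_expand (q q' r r' : 'I_4 -> 'I_4 -> R) G G' (e : R) :
  lag3 (fun j a => q j a + e * q' j a) (fun j a => r j a + e * r' j a)
    (fun c j a => G c j a + e * G' c j a) =
  lag3 q r G + e * (lag3 q' r G + lag3 q r' G + lag3 q r G')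
  + e ^+ 2 * (lag3 q' r' G + lag3 q' r G' + lag3 q r' G')
  + e ^+ 3 * lag3 q' r' G'.
Proof.
rewrite /lag3 !(=^~ big_split, mulr_sumr) /=; apply: eq_bigr => j _.
transitivity (s j * quad (fun a => lvec q a + e * lvec q' a)
    (fun a => r j a + e * r' j a)
    (fun a b => dform (fun a => G a j) a b + e * dform (fun a => G' a j) a b)).
  rewrite /quad /lvec /dform; ring.
rewrite quad_expand; ring.
Qed.

Lemma lag3_0l q r G : (forall j a, q j a = 0) -> lag3 q r G = 0.
Proof.
by move=> q0; rewrite /lag3 big1// => j _; rewrite /quad /lvec !q0; ring.
Qed.

Lemma lag3_0m q r G : (forall j a, r j a = 0) -> lag3 q r G = 0.
Proof.
by move=> r0; rewrite /lag3 big1// => j _; rewrite /quad !r0; ring.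
Qed.

Lemma lag3_0r q r G : (forall c j a, G c j a = 0) -> lag3 q r G = 0.
Proof.
by move=> G0; rewrite /lag3 big1// => j _; rewrite /quad /dform !G0; ring.
Qed.

Definition variation1 : R :=
  lag3 (rotated p) p D + lag3 p (rotated p) D + lag3 p p drotated.

Definition pair3 (k j m : 'I_4) : R := quad (p k) (p j) (dform (fun a => D a m)).

(** What multiplies F once dF has been integrated by parts. Varying theta^j in T^ax gives l /\
    theta^m /\ dtheta^j, and the term -d(l /\ theta^j /\ theta^m) left by the boundary form gives it
    again, hence the factor 2. That term also cancels l /\ theta^j /\ dtheta^m and brings in
    -theta^j /\ theta^m /\ dl, split according to l = theta^0 + theta^3. *)
Definition euler_form : R :=
  \sum_j s j * (\sum_k (F i0 k + F i3 k) * pair3 k j j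
    + \sum_m F j m * (2 * (pair3 i0 m j + pair3 i3 m j)
                      - pair3 j m i0 - pair3 j m i3)).

(** The product-rule expansion of the derivative in direction c of a component of the boundary
    3-form; [boundary_partial] identifies it with an actual derivative. *)
Definition dboundary (c a b d : 'I_4) : R :=
  \sum_j s j * \sum_m (dF c j m * tri (lvec p) (p j) (p m) a b d
   + F j m * (tri (lvec (D c)) (p j) (p m) a b d
              + tri (lvec p) (D c j) (p m) a b d
              + tri (lvec p) (p j) (D c m) a b d)).

Definition variation2 : R :=
  lag3 (rotated p) (rotated p) D + lag3 (rotated p) p drotated + lag3 p (rotated p) drotated.

Definition variation3 : R := lag3 (rotated p) (rotated p) drotated.

Lemma quad_lvec (q : 'I_4 -> 'I_4 -> R) v t :
  quad (lvec q) v t = quad (q i0) v t + quad (q i3) v t.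
Proof. exact: quadDl. Qed.

Lemma quad_dform_lvec u v (G : 'I_4 -> 'I_4 -> 'I_4 -> R) :
  quad u v (dform (fun a => lvec (G a))) =
  quad u v (dform (fun a => G a i0)) + quad u v (dform (fun a => G a i3)).
Proof. rewrite /quad /dform /lvec; ring. Qed.

Lemma first_variation :
  variation1 = dboundary i0 i1 i2 i3 - dboundary i1 i0 i2 i3
             + dboundary i2 i0 i1 i3 - dboundary i3 i0 i1 i2 + euler_form.
Proof.
rewrite /variation1 /lag3 /dboundary /euler_form !(=^~ sumrB, =^~ big_split) /=.
apply: eq_bigr => j _.
rewrite !(=^~ mulrBr, =^~ mulrDr); congr (_ * _).
rewrite quad_dform_sum quad_sumr [quad (lvec (rotated p)) _ _]quad_lvec.
rewrite !quad_suml !(=^~ sumrB, =^~ big_split) /=.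
apply: eq_bigr => m _.
have := tri_divergence (lvec p) (p j) (p m) (fun c => lvec (D c))
   (fun c => D c j) (fun c => D c m).
(* [vol4_rot] moves dF to the front, where its four components multiply those of l /\ theta^j /\
   theta^m as in [dboundary]. *)
rewrite /= vol4_rot quad_dform_lvec !quad_lvec /pair3 /vol4.
set S0 := tri (lvec (D i0)) _ _ _ _ _ + _ + _.
set S1 := tri (lvec (D i1)) _ _ _ _ _ + _ + _.
set S2 := tri (lvec (D i2)) _ _ _ _ _ + _ + _.
set S3 := tri (lvec (D i3)) _ _ _ _ _ + _ + _.
(* [E] evaluates only the alternating sum, so [S0] is expressed through it and the remaining sums
   cancel. *)
move=> E; have -> : S0 = (S0 - S1 + S2 - S3) + S1 - S2 + S3 by ring.
rewrite E; ring.
Qed.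
End FirstVariation.

End ExteriorAlgebra.

(** * Calculus rules for partial derivatives and for continuity on U *)

Section PartialRules.
Context {R : realType}.
Implicit Types (f k : 'rV[R]_4 -> R) (x : 'rV[R]_4) (c : 'I_4).

(** Differentiability travels with the value because the sum and product rules consume it;
    derivatives of composite expressions are then found by successive [apply]. *)
Definition has_partial x c f (d : R) := differentiable f x /\ partial c f x = d.

Lemma has_partialE x c f d : has_partial x c f d -> partial c f x = d.
Proof. by case. Qed.

Lemma differentiable_has_partial x c f :
  differentiable f x -> has_partial x c f (partial c f x).
Proof. by []. Qed.

Lemma has_partial_eq x c f d e :
  has_partial x c f d -> d = e -> has_partial x c f e.
Proof. by move=> h <-. Qed.

Lemma has_partial_cst x c (r : R) : has_partial x c (fun=> r) 0.
Proof. by split; [exact: differentiable_cst | rewrite /partial derive_cst]. Qed.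

Lemma has_partialD x c f k d e : has_partial x c f d -> has_partial x c k e ->
  has_partial x c (fun y => f y + k y) (d + e).
Proof.
move=> [df <-] [dk <-]; split; first exact: differentiableD.
by rewrite /partial deriveD//; exact: diff_derivable.
Qed.

Lemma has_partialN x c f d : has_partial x c f d ->
  has_partial x c (fun y => - f y) (- d).
Proof.
move=> [df <-]; split; first exact: differentiableN.
by rewrite /partial deriveN//; exact: diff_derivable.
Qed.

Lemma has_partialM x c f k d e : has_partial x c f d -> has_partial x c k e ->
  has_partial x c (fun y => f y * k y) (d * k x + f x * e).
Proof.
move=> [df <-] [dk <-]; split; first exact: differentiableM.
rewrite /partial deriveM; [|exact: diff_derivable|exact: diff_derivable].
by rewrite addrC mulrC.
Qed.

Lemma has_partialZ x c f (r d : R) : has_partial x c f d ->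
  has_partial x c (fun y => r * f y) (r * d).
Proof.
move=> hf; have := has_partialM _ _ _ _ _ _ (has_partial_cst x c r) hf.
by rewrite mul0r add0r.
Qed.

Lemma has_partial_sum x c (f : 'I_4 -> 'rV[R]_4 -> R) (d : 'I_4 -> R) :
  (forall i, has_partial x c (f i) (d i)) ->
  has_partial x c (fun y => \sum_i f i y) (\sum_i d i).
Proof.
move=> h; rewrite (_ : (fun y => _) = (fun y => f (inord 0) y + f (inord 1) y
    + f (inord 2) y + f (inord 3) y)); last first.
  by apply/funext => y; rewrite sum4.
rewrite sum4; do 3 ?[apply: has_partialD => //].
Qed.

Lemma has_partial_tri x c (u v w : 'I_4 -> 'rV[R]_4 -> R) (du dv dw : 'I_4 -> R)
    a b d :
  (forall i, has_partial x c (u i) (du i)) ->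
  (forall i, has_partial x c (v i) (dv i)) ->
  (forall i, has_partial x c (w i) (dw i)) ->
  has_partial x c (fun y => tri (u^~ y) (v^~ y) (w^~ y) a b d)
    (tri du (v^~ x) (w^~ x) a b d + tri (u^~ x) dv (w^~ x) a b d
     + tri (u^~ x) (v^~ x) dw a b d).
Proof.
move=> hu hv hw; rewrite /tri.
apply: has_partial_eq; first by
  do ?[apply: has_partialD | apply: has_partialM
    | apply: has_partialN | exact: hu | exact: hv | exact: hw].
rewrite /=; ring.
Qed.

Section ContinuousOn.
Variable U : set 'rV[R]_4.

Definition cont_on f := forall x, U x -> {for x, continuous f}.

Lemma cont_on_cst (r : R) : cont_on (fun=> r).
Proof. by move=> x _; exact: cst_continuous. Qed.

Lemma cont_onD f k : cont_on f -> cont_on k -> cont_on (fun y => f y + k y).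
Proof. by move=> cf ck x Ux; exact: (cvgD (cf x Ux) (ck x Ux)). Qed.

Lemma cont_onN f : cont_on f -> cont_on (fun y => - f y).
Proof. by move=> cf x Ux; exact: (cvgN (cf x Ux)). Qed.

Lemma cont_onM f k : cont_on f -> cont_on k -> cont_on (fun y => f y * k y).
Proof. by move=> cf ck x Ux; exact: (cvgM (cf x Ux) (ck x Ux)). Qed.

Lemma cont_on_sum (f : 'I_4 -> 'rV[R]_4 -> R) : (forall i, cont_on (f i)) ->
  cont_on (fun y => \sum_i f i y).
Proof.
move=> h; rewrite (_ : (fun y => _) = (fun y => f (inord 0) y + f (inord 1) y
    + f (inord 2) y + f (inord 3) y)); last first.
  by apply/funext => y; rewrite sum4.
by do 3 ?[apply: cont_onD => //].
Qed.

End ContinuousOn.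

Ltac split_cont := repeat lazymatch goal with
  | |- cont_on ?V (fun y => @?f y + @?g y) => apply: (@cont_onD V f g)
  | |- cont_on ?V (fun y => @?f y * @?g y) => apply: (@cont_onM V f g)
  | |- cont_on ?V (fun y => - @?f y) => apply: (@cont_onN V f)
  end.

Lemma cont_on_tri U (u v w : 'I_4 -> 'rV[R]_4 -> R) a b d :
  (forall i, cont_on U (u i)) -> (forall i, cont_on U (v i)) ->
  (forall i, cont_on U (w i)) ->
  cont_on U (fun y => tri (u^~ y) (v^~ y) (w^~ y) a b d).
Proof.
move=> hu hv hw; rewrite /tri.
by split_cont; solve [exact: hu | exact: hv | exact: hw].
Qed.

Lemma cont_on_quad U (u v : 'I_4 -> 'rV[R]_4 -> R) (t : 'I_4 -> 'I_4 -> 'rV[R]_4 -> R) :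
  (forall i, cont_on U (u i)) -> (forall i, cont_on U (v i)) ->
  (forall i j, cont_on U (t i j)) ->
  cont_on U (fun y => quad (u^~ y) (v^~ y) (fun a b => t a b y)).
Proof.
move=> hu hv ht; rewrite /quad.
by split_cont; solve [exact: hu | exact: hv | exact: ht].
Qed.

Lemma cont_on_lag3 U (s : 'I_4 -> R) (q r : 'I_4 -> 'I_4 -> 'rV[R]_4 -> R)
    (G : 'I_4 -> 'I_4 -> 'I_4 -> 'rV[R]_4 -> R) :
  (forall j a, cont_on U (q j a)) -> (forall j a, cont_on U (r j a)) ->
  (forall c j a, cont_on U (G c j a)) ->
  cont_on U (fun y => lag3 s (fun j a => q j a y) (fun j a => r j a y)
    (fun c j a => G c j a y)).
Proof.
move=> hq hr hG; apply: cont_on_sum => j; apply: cont_onM.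
  exact: cont_on_cst.
apply: (cont_on_quad U (fun a y => q (inord 0) a y + q (inord 3) a y) (r j)
  (fun a b y => G a j b y - G b j a y)) => //.
  by move=> a; apply: cont_onD.
by move=> a b; apply: cont_onD => //; apply: cont_onN.
Qed.

Lemma eq_cont_on U f k : open U -> (forall x, U x -> f x = k x) ->
  cont_on U k -> cont_on U f.
Proof.
move=> oU fk ck x Ux; apply: (near_eq_continuous_at _ k f x _ (ck x Ux)).
by apply: filterS (near_open U oU x Ux) => y; exact: fk.
Qed.

Lemma differentiable_cont_on U f : (forall x, U x -> differentiable f x) ->
  cont_on U f.
Proof. by move=> df x Ux; exact/differentiable_continuous/df. Qed.

Lemma smooth_differentiable U f x : smooth U f -> U x -> differentiable f x.
Proof. by move=> sf Ux; exact: (sf [::] x Ux). Qed.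

(** [foldr] applies the last index of the list first, so the extra derivative is appended at the
    end. *)
Lemma smooth_partial U f a : smooth U f -> smooth U (partial a f).
Proof. by move=> sf s x Ux; have := sf (rcons s a) x Ux; rewrite foldr_rcons. Qed.

Lemma smooth_cont_on U f : smooth U f -> cont_on U f.
Proof. by move=> sf; apply: differentiable_cont_on => x; exact: smooth_differentiable. Qed.

End PartialRules.

(** * Linearity, positivity and integration of derivatives for [integral_on] *)

Section IntegralOn.
Context {R : realType} (U K : set 'rV[R]_4).
Hypotheses (oU : open U) (cK : compact K) (KU : K `<=` U).
Implicit Types (f k W : 'rV[R]_4 -> R).

Definition cont_supp f := supported U K f /\ cont_on U f.

Lemma cont_supp_box f k : cont_supp f -> cont_supp k ->
  exists N M M', [/\ 0 < N, box_bounded [set: 'I_4]%SET N M (f \_ U)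
    & box_bounded [set: 'I_4]%SET N M' (k \_ U)].
Proof.
move=> [f0 cf] [k0 ck]; have [N N0 KN] := compact_box K cK.
have [M bM] := patch_box_bounded U K oU cK KU f N f0 cf KN.
have [M' bM'] := patch_box_bounded U K oU cK KU k N k0 ck KN.
by exists N, M, M'.
Qed.

Lemma eq_integral_on f k : (forall x, U x -> f x = k x) ->
  integral_on U f = integral_on U k.
Proof.
move=> fk; suff fkU : f \_ U = k \_ U.
  by rewrite (integral_onE U f) (integral_onE U k) fkU.
by apply/funext => x; rewrite !patchE; case: ifPn => // /set_mem /fk.
Qed.

Lemma cont_suppD f k : cont_supp f -> cont_supp k ->
  cont_supp (fun x => f x + k x).
Proof.
move=> [f0 cf] [k0 ck]; split; last exact: cont_onD.
by move=> x Ux nK; rewrite f0// k0// addr0.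
Qed.

Lemma cont_suppZ f (r : R) : cont_supp f -> cont_supp (fun x => r * f x).
Proof.
move=> [f0 cf]; split; last by apply: cont_onM => //; exact: cont_on_cst.
by move=> x Ux nK; rewrite f0// mulr0.
Qed.

Lemma integral_onD f k : cont_supp f -> cont_supp k ->
  integral_on U (fun x => f x + k x) = integral_on U f + integral_on U k.
Proof.
move=> cf ck; have [N [M [M' [N0 bf bk]]]] := cont_supp_box f k cf ck.
rewrite (integral_onE U f) (integral_onE U k) (integral_onE U (fun x => _)).
have -> : (fun x => f x + k x) \_ U = (f \_ U) \+ (k \_ U).
  by apply/funext => x; rewrite /= !patchE; case: ifPn => // _; rewrite addr0.
by rewrite (int4D _ _ _ _ _ N0 bf bk).
Qed.

Lemma integral_onZ f (r : R) : cont_supp f ->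
  integral_on U (fun x => r * f x) = r * integral_on U f.
Proof.
move=> cf; have [N [M [M' [N0 bf _]]]] := cont_supp_box f f cf cf.
rewrite (integral_onE U f) (integral_onE U (fun x => _)).
have -> : (fun x => r * f x) \_ U = r \*o (f \_ U).
  by apply/funext => x; rewrite /= !patchE; case: ifPn => // _; rewrite mulr0.
by rewrite (int4Z _ _ _ _ N0 bf).
Qed.

Lemma integral_on_gt0 f p : cont_supp f -> (forall x, U x -> 0 <= f x) ->
  U p -> 0 < f p -> 0 < integral_on U f.
Proof.
move=> cf f0 Up fp; have [N [M [M' [N0 bf _]]]] := cont_supp_box f f cf cf.
(* The base point of the iterated integral is moved to [p], because [int4_gt0] wants positivity at
   the base point. *)
rewrite (integral_onE U f) (int4_const _ _ p); apply: (int4_gt0 _ _ _ _ N0 bf).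
  by move=> x; rewrite patchE; case: ifPn => // /set_mem /f0.
by rewrite patchE mem_set.
Qed.

Lemma supported_partial W b : supported U K W -> supported U K (partial b W).
Proof.
move=> W0 x Ux nK; rewrite /partial (@near_eq_derive _ _ _ W (cst 0)).
  by rewrite derive_cst.
have nU := near_open U oU x Ux; have nnK := near_off_supp K cK x nK.
by apply: filterS2 nU nnK => y Uy nKy; rewrite W0.
Qed.

Lemma integral_on_partial W b : supported U K W ->
  (forall x, U x -> differentiable W x) -> cont_on U (partial b W) ->
  integral_on U (partial b W) = 0.
Proof.
move=> W0 dW cW.
have cfW : cont_supp W by split=> //; exact: differentiable_cont_on.
have cfdW : cont_supp (partial b W) by split=> //; exact: supported_partial.
have [N [M [M' [N0 bf bk]]]] := cont_supp_box _ _ cfW cfdW.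
have [M1 [NM1 NM2]] : exists M1, M <= M1 /\ M' <= M1.
  by exists (Num.max M M'); rewrite !le_max !lexx orbT.
have bf1 := box_bounded_le _ _ _ _ _ _ (lexx N) NM1 bf.
have bk1 := box_bounded_le _ _ _ _ _ _ (lexx N) NM2 bk.
have sd := patch_slice_derive U K oU cK KU W b W0 dW.
by rewrite (integral_onE U (partial b W)) (int4_derive0 _ _ _ _ _ N0 bf1 bk1 sd).
Qed.

End IntegralOn.

(** * The first variation of the action *)

Section Variation.
Context {R : realType}.
Implicit Types (theta : quartet R) (F : tensor2 R R) (x : 'rV[R]_4).

Lemma is_derive_cubic (r a b c : R) : is_derive (0 : R) (1 : R)
  (fun e : R => r * (e * a + (e ^+ 2 * b + e ^+ 3 * c))) (r * a).
Proof.
have -> : (fun e : R => r * (e * a + (e ^+ 2 * b + e ^+ 3 * c))) =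
   (r * a) *: (@idfun R) + ((r * b) *: (@idfun R ^+ 2) + (r * c) *: (@idfun R ^+ 3)).
  by apply/funext => e; rewrite !fctE /=; rewrite -![_ *: _]/(_ * _); ring.
have d1 := is_derive_id (0 : R) (1 : R).
have d2 := is_deriveX 2 d1; have d3 := is_deriveX 3 d1.
have D := is_deriveD (is_deriveZ (r * a) d1)
  (is_deriveD (is_deriveZ (r * b) d2) (is_deriveZ (r * c) d3)).
set v := (X in is_derive _ _ _ X) in D.
have vE : v = r * a by rewrite /v -![_ *: _]/(_ * _) expr0n /=; ring.
by rewrite vE in D; exact: D.
Qed.

Definition sgn_o (j : 'I_4) : R := o R j j.

Lemma sum_o (j : 'I_4) (f : 'I_4 -> R) : \sum_k o R j k * f k = sgn_o j * f j.
Proof.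
rewrite (bigD1 j)//= big1 ?addr0// => k kj.
by rewrite /o eq_sym kj mul0r.
Qed.

Definition values theta x (j a : 'I_4) : R := theta j a x.
Definition partials theta x (c j a : 'I_4) : R := partial c (theta j a) x.
Definition partials2 F x (c j k : 'I_4) : R := partial c (F j k) x.
Definition values2 F x (j k : 'I_4) : R := F j k x.

Lemma lagrangianE theta x : lagrangian theta x =
  3^-1 * lag3 sgn_o (values theta x) (values theta x) (partials theta x).
Proof.
have tE a b c : axial_torsion theta a b c x =
    3^-1 * \sum_j sgn_o j * wedge12 (theta j) (ext_d (theta j)) a b c x.
  by rewrite /axial_torsion; congr (_ * _); apply: eq_bigr => j _; rewrite sum_o.
rewrite /lagrangian /wedge13_0123 !tE /lag3.
rewrite !(mulrCA _ 3^-1) -!(mulrBr, mulrDr); congr (_ * _).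
rewrite !mulr_sumr !(=^~ sumrB, =^~ big_split) /=; apply: eq_bigr => j _.
(* The two sides are now convertible: [quad] lists its terms in the order in which [wedge13_0123] of
   [wedge12] unfolds. *)
rewrite !(mulrCA _ (sgn_o j)) -!(mulrBr, mulrDr); congr (_ * _).
Qed.

Definition var1 theta F x := variation1 sgn_o (values theta x)
  (partials theta x) (values2 F x) (partials2 F x).
Definition var2 theta F x := variation2 sgn_o (values theta x)
  (partials theta x) (values2 F x) (partials2 F x).
Definition var3 theta F x := variation3 sgn_o (values theta x)
  (partials theta x) (values2 F x) (partials2 F x).
Definition euler theta F x := euler_form sgn_o (values theta x)
  (partials theta x) (values2 F x).
(* The components of o_jk F^j_m l /\ theta^k /\ theta^m, whose exterior
   derivative is the divergence part of the first variation. *)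
Definition boundary theta F (a b d : 'I_4) x : R :=
  \sum_j sgn_o j * \sum_m values2 F x j m *
    tri (lvec (values theta x)) (values theta x j) (values theta x m) a b d.

Section Smooth.
Variables (U K : set 'rV[R]_4) (theta : quartet R) (F : tensor2 R R).
Hypotheses (oU : open U) (cK : compact K) (KU : K `<=` U).
Hypothesis smooth_theta : forall j a, smooth U (theta j a).
Hypothesis smooth_F : forall j k, smooth U (F j k).
Hypothesis F0 : forall j k x, ~ K x -> F j k x = 0.

Let th_partial x c j a : U x ->
  has_partial x c (theta j a) (partials theta x c j a).
Proof. by move=> Ux; split => //; exact: smooth_differentiable (smooth_theta j a) Ux. Qed.

Let F_partial x c j k : U x -> has_partial x c (F j k) (partials2 F x c j k).
Proof. by move=> Ux; split => //; exact: smooth_differentiable (smooth_F j k) Ux. Qed.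

Let dF0 x c j k : ~ K x -> partials2 F x c j k = 0.
Proof. by move=> nK; exact: (partial_supported K cK _ _ (F0 j k)). Qed.

Lemma varied_partial x (e : R) c j a : U x ->
  partials (varied theta F e) x c j a = partials theta x c j a
  + e * drotated (values theta x) (partials theta x) (values2 F x) (partials2 F x) c j a.
Proof.
move=> Ux; apply: has_partialE; rewrite /varied /drotated.
apply: has_partialD; first exact: th_partial.
apply: has_partialZ; apply: has_partial_sum => k.
by apply: has_partialM; [exact: F_partial|exact: th_partial].
Qed.

Lemma lagrangian_varied x (e : R) : U x ->
  lagrangian (varied theta F e) x - lagrangian theta x =
  3^-1 * (e * var1 theta F x + (e ^+ 2 * var2 theta F x + e ^+ 3 * var3 theta F x)).
Proof.
move=> Ux; rewrite !lagrangianE.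
rewrite (_ : values (varied theta F e) x =
  (fun j a => values theta x j a + e * rotated (values2 F x) (values theta x) j a))//.
rewrite (_ : partials (varied theta F e) x = (fun c j a => partials theta x c j a
  + e * drotated (values theta x) (partials theta x) (values2 F x) (partials2 F x) c j a)).
  rewrite lag3_expand /var1 /var2 /var3 /variation1 /variation2 /variation3; ring.
by do 3 (apply/funext => ?); exact: varied_partial.
Qed.

Let cont_th j a : cont_on U (theta j a).
Proof. exact: smooth_cont_on. Qed.
Let cont_dth c j a : cont_on U (partial c (theta j a)).
Proof. by apply: smooth_cont_on; exact: smooth_partial. Qed.
Let cont_F j k : cont_on U (F j k).
Proof. exact: smooth_cont_on. Qed.
Let cont_dF c j k : cont_on U (partial c (F j k)).
Proof. by apply: smooth_cont_on; exact: smooth_partial. Qed.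
Let cont_rot j a : cont_on U (fun x => rotated (values2 F x) (values theta x) j a).
Proof.
by apply: cont_on_sum => k; apply: cont_onM; [exact: cont_F|exact: cont_th].
Qed.
Let cont_drot c j a : cont_on U (fun x => drotated (values theta x)
  (partials theta x) (values2 F x) (partials2 F x) c j a).
Proof.
apply: cont_on_sum => k; apply: cont_onD; apply: cont_onM.
- exact: cont_dF.
- exact: cont_th.
- exact: cont_F.
- exact: cont_dth.
Qed.

Let rot0 x j a : ~ K x -> rotated (values2 F x) (values theta x) j a = 0.
Proof. by move=> nK; rewrite /rotated big1// => k _; rewrite /values2 F0// mul0r. Qed.
Let drot0 x c j a : ~ K x -> drotated (values theta x)
  (partials theta x) (values2 F x) (partials2 F x) c j a = 0.
Proof.
move=> nK; rewrite /drotated big1// => k _.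
by rewrite dF0// /values2 F0// !mul0r addr0.
Qed.

(** Each term has a slot filled by [rotated] or [drotated]. Both vanish off [K], the latter because
    [K] is closed, so that F vanishes near every point outside it. *)
Lemma cont_supp_variation1 : cont_supp U K (var1 theta F).
Proof.
split.
  move=> x Ux nK; rewrite /var1 /variation1.
  rewrite lag3_0l; last by move=> *; exact: rot0.
  rewrite lag3_0m; last by move=> *; exact: rot0.
  rewrite lag3_0r; last by move=> *; exact: drot0.
  by rewrite !addr0.
rewrite /var1 /variation1; apply: cont_onD; first apply: cont_onD.
- by apply: (cont_on_lag3 U sgn_o (fun j a x => rotated (values2 F x) (values theta x) j a)
     theta (fun c j a => partial c (theta j a))).
- by apply: (cont_on_lag3 U sgn_o theta (fun j a x => rotated (values2 F x) (values theta x) j a)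
     (fun c j a => partial c (theta j a))).
- by apply: (cont_on_lag3 U sgn_o theta theta (fun c j a x => drotated (values theta x)
  (partials theta x) (values2 F x) (partials2 F x) c j a)).
Qed.

Lemma cont_supp_variation2 : cont_supp U K (var2 theta F).
Proof.
split.
  move=> x Ux nK; rewrite /var2 /variation2.
  rewrite lag3_0l; last by move=> *; exact: rot0.
  rewrite lag3_0l; last by move=> *; exact: rot0.
  rewrite lag3_0r; last by move=> *; exact: drot0.
  by rewrite !addr0.
rewrite /var2 /variation2; apply: cont_onD; first apply: cont_onD.
- by apply: (cont_on_lag3 U sgn_o (fun j a x => rotated (values2 F x) (values theta x) j a)
    (fun j a x => rotated (values2 F x) (values theta x) j a) (fun c j a => partial c (theta j a))).
- by apply: (cont_on_lag3 U sgn_o (fun j a x => rotated (values2 F x) (values theta x) j a)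
     theta (fun c j a x => drotated (values theta x)
  (partials theta x) (values2 F x) (partials2 F x) c j a)).
- by apply: (cont_on_lag3 U sgn_o theta (fun j a x => rotated (values2 F x) (values theta x) j a)
   (fun c j a x => drotated (values theta x)
  (partials theta x) (values2 F x) (partials2 F x) c j a)).
Qed.

Lemma cont_supp_variation3 : cont_supp U K (var3 theta F).
Proof.
split.
  move=> x Ux nK; rewrite /var3 /variation3.
  by rewrite lag3_0l// => *; exact: rot0.
by apply: (cont_on_lag3 U sgn_o (fun j a x => rotated (values2 F x) (values theta x) j a)
   (fun j a x => rotated (values2 F x) (values theta x) j a) (fun c j a x => drotated (values theta x)
  (partials theta x) (values2 F x) (partials2 F x) c j a)).
Qed.

(** Each coefficient is continuous with support in [K], so the cubic integrand may be integrated
    term by term. *)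
Lemma action_diff_varied (e : R) : action_diff U (varied theta F e) theta =
  3^-1 * (e * integral_on U (var1 theta F) + (e ^+ 2 * integral_on U (var2 theta F)
     + e ^+ 3 * integral_on U (var3 theta F))).
Proof.
rewrite /action_diff (eq_integral_on U _ _ (fun x Ux => lagrangian_varied x e Ux)).
have c1 := cont_supp_variation1; have c2 := cont_supp_variation2.
have c3 := cont_supp_variation3.
have d1 := cont_suppZ U K (var1 theta F) e c1.
have d2 := cont_suppZ U K (var2 theta F) (e ^+ 2) c2.
have d3 := cont_suppZ U K (var3 theta F) (e ^+ 3) c3.
have d23 := cont_suppD U K _ _ d2 d3.
have d123 := cont_suppD U K _ _ d1 d23.
rewrite (integral_onZ U K oU cK KU _ _ d123) (integral_onD U K oU cK KU _ _ d1 d23).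
rewrite (integral_onD U K oU cK KU _ _ d2 d3).
rewrite (integral_onZ U K oU cK KU _ _ c1) (integral_onZ U K oU cK KU _ _ c2).
by rewrite (integral_onZ U K oU cK KU _ _ c3).
Qed.

Lemma action_diff_derive : is_derive (0 : R) (1 : R)
  (fun e : R => action_diff U (varied theta F e) theta) (3^-1 * integral_on U (var1 theta F)).
Proof.
have -> : (fun e : R => action_diff U (varied theta F e) theta) =
    (fun e => 3^-1 * (e * integral_on U (var1 theta F)
      + (e ^+ 2 * integral_on U (var2 theta F)
         + e ^+ 3 * integral_on U (var3 theta F)))).
  by apply/funext => e; exact: action_diff_varied.
exact: is_derive_cubic.
Qed.

Lemma boundary_partial x c a b d : U x ->
  has_partial x c (boundary theta F a b d) (dboundary sgn_o (values theta x)
    (partials theta x) (values2 F x) (partials2 F x) c a b d).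
Proof.
move=> Ux; apply: has_partial_sum => j; apply: has_partialZ.
apply: has_partial_sum => m; apply: has_partialM; first exact: F_partial.
apply: (has_partial_tri x c (fun i y => lvec (values theta y) i)
  (theta j) (theta m) (lvec (partials theta x c)) (partials theta x c j)
  (partials theta x c m) a b d) => i.
- by apply: has_partialD; exact: th_partial.
- exact: th_partial.
- exact: th_partial.
Qed.

Lemma boundary_integral c a b d :
  integral_on U (partial c (boundary theta F a b d)) = 0 /\
  cont_supp U K (partial c (boundary theta F a b d)).
Proof.
have b0 : supported U K (boundary theta F a b d).
  move=> x Ux nK; rewrite /boundary big1// => j _.
  by rewrite big1 ?mulr0// => m _; rewrite /values2 F0// mul0r.
have bc : cont_on U (partial c (boundary theta F a b d)).
  apply: (eq_cont_on U _ (fun x => dboundary sgn_o (values theta x)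
    (partials theta x) (values2 F x) (partials2 F x) c a b d) oU).
    by move=> x Ux; exact/has_partialE/boundary_partial.
  have cl i : cont_on U (fun x => lvec (values theta x) i).
    by apply: cont_onD; exact: cont_th.
  have cdl i : cont_on U (fun x => lvec (partials theta x c) i).
    by apply: cont_onD; exact: cont_dth.
  apply: cont_on_sum => j; apply: cont_onM; first exact: cont_on_cst.
  apply: cont_on_sum => m; apply: cont_onD; apply: cont_onM.
  - exact: cont_dF.
  - exact: (cont_on_tri U (fun i y => lvec (values theta y) i) (theta j) (theta m)).
  - exact: cont_F.
  - apply: cont_onD; first apply: cont_onD.
    + exact: (cont_on_tri U (fun i y => lvec (partials theta y c) i) (theta j) (theta m)).
    + exact: (cont_on_tri U (fun i y => lvec (values theta y) i)
        (fun i => partial c (theta j i)) (theta m)).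
    + exact: (cont_on_tri U (fun i y => lvec (values theta y) i) (theta j)
        (fun i => partial c (theta m i))).
split; last by split=> //; exact: supported_partial.
apply: (integral_on_partial U K oU cK KU _ _ b0 _ bc) => x Ux.
by have [] := boundary_partial x c a b d Ux.
Qed.

Lemma cont_on_euler : cont_on U (euler theta F).
Proof.
have cp k j m : cont_on U (fun x => pair3 (values theta x) (partials theta x) k j m).
  apply: (cont_on_quad U (theta k) (theta j)
    (fun a b x => partial a (theta m b) x - partial b (theta m a) x)) => //.
  by move=> a b; apply: cont_onD; [exact: cont_dth|apply: cont_onN; exact: cont_dth].
apply: cont_on_sum => j; apply: cont_onM; first exact: cont_on_cst.
apply: cont_onD; apply: cont_on_sum => k; apply: cont_onM.
- by apply: cont_onD; exact: cont_F.
- exact: cp.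
- exact: cont_F.
- apply: cont_onD; last by apply: cont_onN; exact: cp.
  apply: cont_onD; last by apply: cont_onN; exact: cp.
  by apply: cont_onM; [exact: cont_on_cst|apply: cont_onD; exact: cp].
Qed.

Lemma cont_supp_euler : cont_supp U K (euler theta F).
Proof.
split; last exact: cont_on_euler.
move=> x Ux nK; rewrite /euler /euler_form big1// => j _.
by rewrite !big1 ?addr0 ?mulr0// => k _; rewrite /values2 !F0// ?addr0 ?mul0r.
Qed.

Lemma integral_var1 : integral_on U (var1 theta F) = integral_on U (euler theta F).
Proof.
pose c0 : 'I_4 := inord 0; pose c1 : 'I_4 := inord 1.
pose c2 : 'I_4 := inord 2; pose c3 : 'I_4 := inord 3.
have [i0 s0] := boundary_integral c0 c1 c2 c3.
have [i1 s1] := boundary_integral c1 c0 c2 c3.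
have [i2 s2] := boundary_integral c2 c0 c1 c3.
have [i3 s3] := boundary_integral c3 c0 c1 c2.
have se := cont_supp_euler.
have n1 := cont_suppZ U K _ (-1) s1.
have n3 := cont_suppZ U K _ (-1) s3.
have s23 := cont_suppD U K _ _ s2 n3.
have s123 := cont_suppD U K _ _ n1 s23.
have s0123 := cont_suppD U K _ _ s0 s123.
have e : forall x, U x -> var1 theta F x = (partial c0 (boundary theta F c1 c2 c3) x
   + (-1 * partial c1 (boundary theta F c0 c2 c3) x
   + (partial c2 (boundary theta F c0 c1 c3) x
   + -1 * partial c3 (boundary theta F c0 c1 c2) x))) + euler theta F x.
  move=> x Ux; rewrite !(has_partialE _ _ _ _ (boundary_partial x _ _ _ _ Ux)).
  (* The linearity rules of the integral cover sums and scalar multiples, so differences are written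
     with the factor -1. *)
  have alt (r1 r2 r3 r4 r5 : R) :
    r1 - r2 + r3 - r4 + r5 = r1 + (-1 * r2 + (r3 + -1 * r4)) + r5 by ring.
  by rewrite -alt; exact: first_variation.
rewrite (eq_integral_on U _ _ e) (integral_onD U K oU cK KU _ _ s0123 se).
rewrite (integral_onD U K oU cK KU _ _ s0 s123) (integral_onD U K oU cK KU _ _ n1 s23).
rewrite (integral_onD U K oU cK KU _ _ s2 n3) (integral_onZ U K oU cK KU _ _ s1).
by rewrite (integral_onZ U K oU cK KU _ _ s3) i0 i1 i2 i3 !mulr0 !addr0 add0r.
Qed.

Lemma euler_derive : is_derive (0 : R) (1 : R)
  (fun e : R => action_diff U (varied theta F e) theta)
  (3^-1 * integral_on U (euler theta F)).
Proof. by rewrite -integral_var1; exact: action_diff_derive. Qed.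

End Smooth.
End Variation.

(** * Frame components *)

Section Determinant.
Context {R : comNzRingType}.
Notation i0 := (inord 0 : 'I_4).
Notation i1 := (inord 1 : 'I_4).
Notation i2 := (inord 2 : 'I_4).
Notation i3 := (inord 3 : 'I_4).

Lemma det_vol4 (p : 'I_4 -> 'I_4 -> R) :
  \det (\matrix_(j, a) p j a) = vol4 (p i0) (p i1) (p i2) (p i3).
Proof.
(* With natural numbers as indices, the lifted ordinals of the cofactor expansions compute to
   numerals. *)
pose f (i j : nat) := p (inord i) (inord j).
have -> : (\matrix_(j, a) p j a) = \matrix_(j < 4, a < 4) f j a.
  by apply/matrixP => j a; rewrite !mxE /f !inord_val.
rewrite /vol4 /tri -!/(f _ _).
rewrite (expand_det_row _ ord0) !big_ord_recl big_ord0 /cofactor.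
rewrite !(expand_det_row _ (@ord0 2)) !big_ord_recl !big_ord0 /cofactor.
rewrite !(expand_det_row _ (@ord0 1)) !big_ord_recl !big_ord0 /cofactor.
rewrite !det_mx11 !mxE /= /bump /=.
ring.
Qed.

(** Since t is the sum of [C m n] theta^m /\ theta^n over m < n, the wedge with two coframe elements
    keeps only the term in the two other ones, with the sign of the resulting permutation. *)
Lemma quad_frame (p : 'I_4 -> 'I_4 -> R) (C : 'I_4 -> 'I_4 -> R)
    (t : 'I_4 -> 'I_4 -> R) :
  (forall m n, C n m = - C m n) -> (forall m, C m m = 0) ->
  (forall a b, t a b = \sum_m \sum_n C m n * (p m a * p n b)) ->
  let V := vol4 (p i0) (p i1) (p i2) (p i3) in
  [/\ quad (p i0) (p i1) t = C i2 i3 * V, quad (p i0) (p i2) t = - C i1 i3 * V,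
      quad (p i0) (p i3) t = C i1 i2 * V, quad (p i1) (p i2) t = C i0 i3 * V
    & quad (p i1) (p i3) t = - C i0 i2 * V /\ quad (p i2) (p i3) t = C i0 i1 * V].
Proof.
move=> Casym C0 tE V.
have tE' a b : t a b = C i0 i1 * (p i0 a * p i1 b - p i1 a * p i0 b)
    + C i0 i2 * (p i0 a * p i2 b - p i2 a * p i0 b)
    + C i0 i3 * (p i0 a * p i3 b - p i3 a * p i0 b)
    + C i1 i2 * (p i1 a * p i2 b - p i2 a * p i1 b)
    + C i1 i3 * (p i1 a * p i3 b - p i3 a * p i1 b)
    + C i2 i3 * (p i2 a * p i3 b - p i3 a * p i2 b).
  rewrite tE !sum4 !C0 (Casym i0 i1) (Casym i0 i2) (Casym i0 i3).
  by rewrite (Casym i1 i2) (Casym i1 i3) (Casym i2 i3); ring.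
by rewrite /V /quad /vol4 /tri !tE'; split; [ring|ring|ring|ring|split; ring].
Qed.

End Determinant.

(** * The Euler form in terms of the connection coefficients W *)

Section FrameEuler.
Context {R : realType}.
Notation i0 := (inord 0 : 'I_4).
Notation i1 := (inord 1 : 'I_4).
Notation i2 := (inord 2 : 'I_4).
Notation i3 := (inord 3 : 'I_4).

Lemma sgn_oE : (sgn_o i0 = 1 :> R) * (sgn_o i1 = -1 :> R)
  * (sgn_o i2 = -1 :> R) * (sgn_o i3 = -1 :> R).
Proof. by rewrite /sgn_o /o !eqxx /= -!val_eqE /= !inordK. Qed.

Definition lower_asym (F : 'I_4 -> 'I_4 -> R) :=
  forall j k, sgn_o j * F j k = - (sgn_o k * F k j).

(** Lowering an index changes the sign for 1, 2, 3 but not for 0: entries mixing 0 with a space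
    index are symmetric, the space ones antisymmetric, and six remain. [W] at a fixed direction of
    differentiation is of the same kind. *)
Lemma lower_asymE F : lower_asym F ->
  (forall j, F j j = 0) /\
  [/\ F i1 i0 = F i0 i1, F i2 i0 = F i0 i2, F i3 i0 = F i0 i3,
      F i2 i1 = - F i1 i2 & F i3 i1 = - F i1 i3 /\ F i3 i2 = - F i2 i3].
Proof.
move=> Fa; split.
  move=> j; have := Fa j j.
  have : sgn_o j = 1 :> R \/ sgn_o j = -1 :> R.
    by rewrite /sgn_o /o eqxx /=; case: ifP; [left|right].
  by case=> ->; lra.
have := (Fa i0 i1, Fa i0 i2, Fa i0 i3, Fa i1 i2, Fa i1 i3, Fa i2 i3).
rewrite !sgn_oE => -[[[[[h1 h2] h3] h4] h5] h6].
by split; [lra|lra|lra|lra|split; lra].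
Qed.

(* [W j m n]: the frame components of the covariant derivative of theta^j,
   m being the index of differentiation. *)
Variable W : 'I_4 -> 'I_4 -> 'I_4 -> R.
Hypothesis W_metric : forall k m n, sgn_o k * W k m n + sgn_o n * W n m k = 0.

(** The frame components of v with m replaced by theta^t, expanded by the Leibniz rule. The terms
    are, in order: the derivative of l along theta^t, (div theta^t) l, -(div l) theta^t, minus the
    derivative of theta^t along l, and the last term of v. [lc] holds the frame components of l. *)
Definition frame_v (t n : 'I_4) : R :=
  let Wl m k := W i0 m k + W i3 m k in
  let lc k := (k == i0)%:R + (k == i3)%:R in
  sgn_o t * Wl t n + (\sum_k sgn_o k * W t k k) * lc n
  - (\sum_k sgn_o k * Wl k k) * (n == t)%:R
  - \sum_k lc k * (sgn_o k * W t k n) - sgn_o t * Wl n t.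

Lemma W_metricE m : (forall j, W j m j = 0) /\
  [/\ W i1 m i0 = W i0 m i1, W i2 m i0 = W i0 m i2, W i3 m i0 = W i0 m i3,
      W i2 m i1 = - W i1 m i2 & W i3 m i1 = - W i1 m i3 /\ W i3 m i2 = - W i2 m i3].
Proof.
by apply: (lower_asymE (fun j k => W j m k)) => j k; apply/eqP; rewrite -addr_eq0 W_metric.
Qed.

(** In complex terms v_3 = v_0 and v_2 = i v_1, that is, v = v_0 l + v_1 m. *)
Lemma frame_v_relations :
  [/\ frame_v i1 i3 = frame_v i1 i0, frame_v i2 i3 = frame_v i2 i0,
      frame_v i2 i2 = frame_v i1 i1 & frame_v i2 i1 = - frame_v i1 i2].
Proof.
have neq := (ord4_neq 0 1, ord4_neq 0 2, ord4_neq 0 3).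
rewrite /frame_v !sum4 !sgn_oE !ord4_neq//=.
have [d0 [a01 a02 a03 a12 [a13 a23]]] := W_metricE i0.
have [d1 [b01 b02 b03 b12 [b13 b23]]] := W_metricE i1.
have [d2 [c01 c02 c03 c12 [c13 c23]]] := W_metricE i2.
have [d3 [e01 e02 e03 e12 [e13 e23]]] := W_metricE i3.
rewrite !d0 !d1 !d2 !d3 ?a01 ?a02 ?a03 ?a12 ?a13 ?a23 ?b01 ?b02 ?b03 ?b12 ?b13 ?b23.
rewrite ?c01 ?c02 ?c03 ?c12 ?c13 ?c23 ?e01 ?e02 ?e03 ?e12 ?e13 ?e23.
by split; ring.
Qed.

Variables (p : 'I_4 -> 'I_4 -> R) (D : 'I_4 -> 'I_4 -> 'I_4 -> R).
Hypothesis W_torsion : forall j a b, D a j b - D b j a =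
  \sum_m \sum_n (W j m n - W j n m) * (p m a * p n b).

Let V := vol4 (p i0) (p i1) (p i2) (p i3).

Lemma euler_form_frame F : lower_asym F -> euler_form sgn_o p D F =
  2 * V * (F i0 i1 * frame_v i2 i0 - F i0 i2 * frame_v i1 i0
           + F i0 i3 * frame_v i1 i2 - F i1 i2 * frame_v i1 i1
           - F i1 i3 * frame_v i2 i0 + F i2 i3 * frame_v i1 i0).
Proof.
move=> Fa; have [Fd [f01 f02 f03 f12 [f13 f23]]] := lower_asymE F Fa.
(* By torsion-freeness these differences are the frame components of dtheta^m. *)
have Q m := quad_frame p (fun k n => W m k n - W m n k) (dform (fun a => D a m))
  (fun k n => esym (opprB _ _)) (fun k => subrr _) (W_torsion m).
have pC k j m : pair3 p D j k m = - pair3 p D k j m by exact: quadC.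
have p0 k m : pair3 p D k k m = 0 by exact: quad_same.
have [q01 q02 q03 q12 [q13 q23]] : [/\ forall m, pair3 p D i0 i1 m = (W m i2 i3 - W m i3 i2) * V,
   forall m, pair3 p D i0 i2 m = - (W m i1 i3 - W m i3 i1) * V,
   forall m, pair3 p D i0 i3 m = (W m i1 i2 - W m i2 i1) * V,
   forall m, pair3 p D i1 i2 m = (W m i0 i3 - W m i3 i0) * V &
   (forall m, pair3 p D i1 i3 m = - (W m i0 i2 - W m i2 i0) * V) /\
   (forall m, pair3 p D i2 i3 m = (W m i0 i1 - W m i1 i0) * V)].
  by split; [| | | |split] => m; have [? ? ? ? [? ?]] := Q m.
rewrite /euler_form !sum4 !sgn_oE !p0 !Fd f01 f02 f03 f12 f13 f23.
rewrite !(pC i0 i1) !(pC i0 i2) !(pC i0 i3) !(pC i1 i2) !(pC i1 i3) !(pC i2 i3).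
rewrite !q01 !q02 !q03 !q12 !q13 !q23.
rewrite /frame_v !sum4 !sgn_oE !ord4_neq//=.
(* Metric compatibility leaves 24 independent entries of W, six for each direction of
   differentiation; in these both sides are equal polynomials. *)
have [d0 [a01 a02 a03 a12 [a13 a23]]] := W_metricE i0.
have [d1 [b01 b02 b03 b12 [b13 b23]]] := W_metricE i1.
have [d2 [c01 c02 c03 c12 [c13 c23]]] := W_metricE i2.
have [d3 [e01 e02 e03 e12 [e13 e23]]] := W_metricE i3.
rewrite !d0 !d1 !d2 !d3 ?a01 ?a02 ?a03 ?a12 ?a13 ?a23 ?b01 ?b02 ?b03 ?b12 ?b13 ?b23.
rewrite ?c01 ?c02 ?c03 ?c12 ?c13 ?c23 ?e01 ?e02 ?e03 ?e12 ?e13 ?e23.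
ring.
Qed.

End FrameEuler.

(** * Frame components of the Levi-Civita connection and of v *)

Section FrameGeometry.
Context {R : realType}.
Notation i0 := (inord 0 : 'I_4).
Notation i1 := (inord 1 : 'I_4).
Notation i2 := (inord 2 : 'I_4).
Notation i3 := (inord 3 : 'I_4).
Notation omx := (@omx R).

Lemma mul_omxr m (A : 'M[R]_(m, 4)) i k : (A *m omx) i k = A i k * sgn_o k.
Proof.
rewrite !mxE (bigD1 k)//= big1 ?addr0 ?mxE// => j jk.
by rewrite mxE /o jk mulr0.
Qed.

Lemma mul_omxl m (A : 'M[R]_(4, m)) i k : (omx *m A) i k = sgn_o i * A i k.
Proof.
rewrite !mxE (bigD1 i)//= big1 ?addr0 ?mxE// => j ji.
by rewrite mxE /o eq_sym ji mul0r.
Qed.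

Lemma omx_sq : omx *m omx = 1%:M.
Proof.
apply/matrixP => i k; rewrite mul_omxr !mxE /sgn_o /o eqxx /=.
have [->|ik] := eqVneq i k; last by rewrite mul0r.
by case: ifP => _; rewrite ?mulr1// mulrNN mulr1.
Qed.

Lemma omx_tr : omx^T = omx.
Proof.
apply/matrixP => i k; rewrite !mxE /o eq_sym.
by have [->|] := eqVneq i k.
Qed.

Variables (U : set 'rV[R]_4) (g : tensor2 R R) (theta : quartet R) (x : 'rV[R]_4).
Hypotheses (oU : open U) (Ux : U x).
Hypothesis smooth_theta : forall j a, smooth U (theta j a).
Hypothesis metric : metric_constraint U g theta.
Hypothesis theta_det : 0 < \det (mx_at theta x).

Notation M := (mx_at theta x).
Notation E := (invmx M).
Notation G := (mx_at g x).
Notation Gi := (invmx G).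

Lemma frame_unit : M \in unitmx.
Proof. by rewrite unitmxE unitfE gt_eqF. Qed.

Let ME : M *m E = 1%:M. Proof. exact: mulmxV frame_unit. Qed.
Let EM : E *m M = 1%:M. Proof. exact: mulVmx frame_unit. Qed.

Lemma metric_on a b y : U y ->
  g a b y = \sum_j sgn_o j * (theta j a y * theta j b y).
Proof.
move=> Uy; rewrite metric//; apply: eq_bigr => j _.
rewrite -(sum_o j (fun k => theta j a y * theta k b y)).
by apply: eq_bigr => k _; rewrite mulrA.
Qed.

Lemma metric_sym a b y : U y -> g a b y = g b a y.
Proof.
by move=> Uy; rewrite !metric_on//; apply: eq_bigr => j _; rewrite (mulrC (theta j a y)).
Qed.

Lemma metric_mx : G = M^T *m omx *m M.
Proof.
apply/matrixP => a b; rewrite mxE metric_on// mxE; apply: eq_bigr => j _.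
by rewrite mul_omxr !mxE mulrA (mulrC (sgn_o j)).
Qed.

Lemma metric_inv_mx : invmx G = E *m omx *m E^T.
Proof.
have GE : G *m (E *m omx *m E^T) = 1%:M.
  rewrite metric_mx -!mulmxA (mulmxA M E) ME mul1mx (mulmxA omx omx) omx_sq mul1mx.
  by rewrite -trmx_mul EM trmx1.
have [Gu _] := mulmx1_unit GE.
by rewrite -[LHS]mulmx1 -GE mulmxA mulVmx// mul1mx.
Qed.

Lemma metric_inv_tr : Gi^T = Gi.
Proof. by rewrite metric_inv_mx !trmx_mul trmxK omx_tr mulmxA. Qed.

Lemma metric_invr e s : \sum_d g e d x * ginv g d s x = (e == s)%:R.
Proof.
have Gu : G \in unitmx.
  by rewrite metric_mx !unitmx_mul unitmx_tr frame_unit /= andbT;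
     have [] := mulmx1_unit omx_sq.
have := mulmxV Gu => /matrixP /(_ e s); rewrite !mxE => <-.
by apply: eq_bigr => d _; rewrite mxE.
Qed.

Lemma partial_theta c j a : has_partial x c (theta j a) (partial c (theta j a) x).
Proof. by split => //; exact: smooth_differentiable (smooth_theta j a) Ux. Qed.

Lemma near_eq_partial (f k : 'rV[R]_4 -> R) c :
  (forall y, U y -> f y = k y) -> partial c f x = partial c k x.
Proof.
move=> fk; apply: near_eq_derive.
by apply: filterS (near_open U oU x Ux) => y; exact: fk.
Qed.

Lemma partial_metric c a b : partial c (g a b) x =
  \sum_j sgn_o j * (partial c (theta j a) x * theta j b x
                    + theta j a x * partial c (theta j b) x).
Proof.
rewrite (near_eq_partial _ _ c (metric_on a b)); apply: has_partialE.
apply: has_partial_sum => j; apply: has_partialZ.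
by apply: has_partialM; exact: partial_theta.
Qed.

Lemma partial_metric_sym c a b : partial c (g a b) x = partial c (g b a) x.
Proof. by apply: near_eq_partial => y; exact: metric_sym. Qed.

Lemma christoffel_sym d a b : christoffel g d a b x = christoffel g d b a x.
Proof.
rewrite /christoffel; congr (_ * _); apply: eq_bigr => s _; congr (_ * _).
by rewrite (partial_metric_sym s a b) [_ + partial b _ x]addrC.
Qed.

Lemma christoffel_lower e a b : \sum_d g e d x * christoffel g d a b x =
  2^-1 * (partial a (g e b) x + partial b (g e a) x - partial e (g a b) x).
Proof.
rewrite /christoffel.
under eq_bigr do rewrite mulrCA mulr_sumr.
rewrite -mulr_sumr exchange_big /=; congr (_ * _).
under eq_bigr do under eq_bigr do rewrite mulrA.
under eq_bigr do rewrite -mulr_suml metric_invr.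
rewrite (bigD1 e)//= eqxx mul1r big1 ?addr0// => s se.
by rewrite eq_sym (negbTE se) mul0r.
Qed.

Definition cov_mx (u : covector R R) : 'M[R]_4 := \matrix_(c, a) cov1 g u c a x.
Notation N j := (cov_mx (theta j)).

Lemma cov1_torsion j a b : cov1 g (theta j) a b x - cov1 g (theta j) b a x =
  partial a (theta j b) x - partial b (theta j a) x.
Proof.
rewrite /cov1; under [in X in _ - X]eq_bigr do rewrite christoffel_sym.
by rewrite opprB addrA subrK.
Qed.

(** This is nabla_c g_ab = 0 with g expanded in the coframe: [red] turns the Christoffel terms into
    symbols with all indices down, which [christoffel_lower] writes through derivatives of g. *)
Lemma cov1_metric c a b :
  \sum_j sgn_o j * (cov1 g (theta j) c a x * theta j b x
                    + theta j a x * cov1 g (theta j) c b x) = 0.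
Proof.
have red e f : \sum_j sgn_o j * ((\sum_d christoffel g d c e x * theta j d x) * theta j f x)
   = \sum_d g f d x * christoffel g d c e x.
  under eq_bigr do rewrite mulr_suml mulr_sumr.
  rewrite exchange_big /=; apply: eq_bigr => d _.
  rewrite metric_on// mulr_suml; apply: eq_bigr => j _; ring.
transitivity (partial c (g a b) x - \sum_d g b d x * christoffel g d c a x
   - \sum_d g a d x * christoffel g d c b x).
  rewrite -!red partial_metric -!sumrB; apply: eq_bigr => j _; rewrite /cov1; ring.
rewrite !christoffel_lower (partial_metric_sym _ b a) (partial_metric_sym _ c b).
rewrite (partial_metric_sym _ c a); lra.
Qed.

(** Both indices of nabla theta^j are contracted with the dual frame, whose vectors are the columns
    of [E]. *)
Definition frame_cov (j m n : 'I_4) : R := (E^T *m N j *m E) m n.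

Lemma frame_cov_torsion j a b :
  partials theta x a j b - partials theta x b j a =
  \sum_m \sum_n (frame_cov j m n - frame_cov j n m) *
     (values theta x m a * values theta x n b).
Proof.
rewrite /partials -cov1_torsion.
have Nj : N j = M^T *m (E^T *m N j *m E) *m M.
  by rewrite !mulmxA -trmx_mul EM trmx1 mul1mx -mulmxA EM mulmx1.
have e c d : cov1 g (theta j) c d x = \sum_m \sum_n frame_cov j m n * (theta m c x * theta n d x).
  transitivity (N j c d); first by rewrite mxE.
  rewrite {1}Nj mxE exchange_big /=; apply: eq_bigr => n _.
  rewrite [in LHS]mxE mulr_suml; apply: eq_bigr => m _.
  have Mv i k : M i k = theta i k x by rewrite mxE.
  by rewrite -/(frame_cov j m n) [M^T c m]mxE !Mv; ring.
rewrite !e [in X in _ - X]exchange_big /= -sumrB; apply: eq_bigr => m _.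
by rewrite -sumrB; apply: eq_bigr => n _; rewrite /values; ring.
Qed.

(** In matrices [cov1_metric] reads A^T omx M + M^T omx A = 0. Multiplying by [E^T] on the left and
    [E] on the right makes omx A E antisymmetric; contracting c with [E] completes the change of
    frame. *)
Lemma frame_cov_metric k m n :
  sgn_o k * frame_cov k m n + sgn_o n * frame_cov n m k = 0.
Proof.
pose A c := \matrix_(j, a) cov1 g (theta j) c a x : 'M[R]_4.
have WA j p q : frame_cov j p q = \sum_c E c p * (A c *m E) j q.
  rewrite /frame_cov -mulmxA mxE; apply: eq_bigr => c _; rewrite mxE; congr (_ * _).
  by rewrite !mxE; apply: eq_bigr => a _; rewrite !mxE.
have compat c : sgn_o k * (A c *m E) k n + sgn_o n * (A c *m E) n k = 0.
  have X0 : (A c)^T *m omx *m M + M^T *m omx *m A c = 0.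
    apply/matrixP => a b; rewrite [RHS]mxE -(cov1_metric c a b) !mxE -big_split /=.
    by apply: eq_bigr => j _; rewrite !mul_omxr !mxE; ring.
  have : E^T *m ((A c)^T *m omx *m M + M^T *m omx *m A c) *m E = 0.
    by rewrite X0 mulmx0 mul0mx.
  rewrite mulmxDr mulmxDl !mulmxA -!trmx_mul ME trmx1 mul1mx.
  rewrite -(mulmxA _ M E) ME mulmx1 -(mulmxA omx (A c) E) => /matrixP /(_ n k).
  rewrite mxE mul_omxr mul_omxl [(_^T) n k]mxE [RHS]mxE => <-.
  by rewrite (mulrC _ (sgn_o k)).
rewrite !WA !mulr_sumr -big_split /= big1// => c _.
by rewrite !(mulrCA _ (E c m)) -mulrDr compat mulr0.
Qed.

Lemma cov1_lcov c a : cov1 g (lcov theta) c a x =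
  cov1 g (theta i0) c a x + cov1 g (theta i3) c a x.
Proof.
rewrite /cov1 (_ : partial c (lcov theta a) x =
  partial c (theta i0 a) x + partial c (theta i3 a) x).
  under eq_bigr do rewrite mulrDr.
  by rewrite big_split /= opprD addrACA.
by apply: has_partialE; apply: has_partialD; exact: partial_theta.
Qed.

Lemma cov2_wedge (u w : covector R R) c a b :
  (forall i, differentiable (u i) x) -> (forall i, differentiable (w i) x) ->
  cov2 g (wedge11 u w) c a b x =
  cov1 g u c a x * w b x + u a x * cov1 g w c b x
  - cov1 g u c b x * w a x - u b x * cov1 g w c a x.
Proof.
move=> du dw.
have hu i := differentiable_has_partial _ c _ (du i).
have hw i := differentiable_has_partial _ c _ (dw i).
rewrite /cov2 (_ : partial c (wedge11 u w a b) x =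
  (partial c (u a) x * w b x + u a x * partial c (w b) x)
  - (partial c (u b) x * w a x + u b x * partial c (w a) x)).
  rewrite /cov1 /wedge11 !sum4; ring.
by apply: has_partialE; apply: has_partialD; [|apply: has_partialN]; exact: has_partialM.
Qed.

(** Since v is linear in m and l is real, t = 1 and t = 2 give the real and imaginary parts of v. *)
Definition vre (t a : 'I_4) : R :=
  \sum_b \sum_c ginv g b c x * cov2 g (wedge11 (lcov theta) (theta t)) c a b x
  - \sum_b (\sum_c ginv g b c x * theta t c x) * cov1 g (lcov theta) a b x.

Lemma sum_Complex (f k : 'I_4 -> R) :
  \sum_i Complex (f i) (k i) = Complex (\sum_i f i) (\sum_i k i).
Proof. by rewrite !sum4. Qed.

Lemma mul_RComplex (r p q : R) : r%:C%C * Complex p q = Complex (r * p) (r * q).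
Proof. by simpc. Qed.

Lemma vcovE a : vcov g theta a x = Complex (vre i1 a) (vre i2 a).
Proof.
rewrite /vcov /vre /mcov /cov2C.
under eq_bigr do under eq_bigr do rewrite mul_RComplex.
under eq_bigr do rewrite sum_Complex.
rewrite sum_Complex.
under [X in _ - X]eq_bigr do under eq_bigr do rewrite mul_RComplex.
under [X in _ - X]eq_bigr do rewrite sum_Complex mulrC mul_RComplex.
rewrite sum_Complex.
rewrite -[LHS]/(Complex (_ - _) (_ - _)).
have eRe : (fun b c y => complex.Re (wedge11 (fun a x => (lcov theta a x)%:C%C)
   (fun a x => Complex (theta i1 a x) (theta i2 a x)) b c y)) = wedge11 (lcov theta) (theta i1).
  by apply/funext => b; apply/funext => c; apply/funext => y; rewrite /wedge11 !mul_RComplex.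
have eIm : (fun b c y => complex.Im (wedge11 (fun a x => (lcov theta a x)%:C%C)
   (fun a x => Complex (theta i1 a x) (theta i2 a x)) b c y)) = wedge11 (lcov theta) (theta i2).
  by apply/funext => b; apply/funext => c; apply/funext => y; rewrite /wedge11 !mul_RComplex.
by congr Complex; rewrite ?eRe ?eIm; congr (_ - _); apply: eq_bigr => b _; rewrite mulrC.
Qed.

(** In matrix form the passage to the frame is multiplication by [E] on the right, where the factor
    [E] of [Gi] cancels against the rows of [M]. *)
Lemma vre_mx t : \row_a vre t a =
  row t M *m Gi *m cov_mx (lcov theta)
  + \tr (Gi *m N t) *: \row_a lcov theta a x
  - \tr (Gi *m cov_mx (lcov theta)) *: row t M
  - (\row_a lcov theta a x) *m Gi *m N t
  - row t M *m Gi *m (cov_mx (lcov theta))^T.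
Proof.
set l := lcov theta.
have dth j i : differentiable (theta j i) x by have [] := partial_theta i0 j i.
have dl i : differentiable (l i) x by apply: differentiableD; exact: dth.
apply/rowP => a; rewrite [LHS]mxE.
have tr_E (A : 'M[R]_4) : \tr (Gi *m A) = \sum_b \sum_c ginv g b c x * A c b.
  by rewrite /mxtrace; apply: eq_bigr => b _; rewrite mxE.
have row_E (w : 'rV[R]_4) (A : 'M[R]_4) :
    (w *m Gi *m A) 0 a = \sum_b \sum_c ginv g b c x * (w 0 b * A c a).
  rewrite -mulmxA mxE; apply: eq_bigr => b _; rewrite mxE mulr_sumr.
  by apply: eq_bigr => c _; rewrite mulrCA.
have rowT_E : (row t M *m Gi *m (cov_mx l)^T) 0 a =
    \sum_b (\sum_c ginv g b c x * theta t c x) * cov1 g l a b x.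
  rewrite mxE; apply: eq_bigr => b _; rewrite [_^T _ _]mxE [cov_mx _ _ _]mxE; congr (_ * _).
  (* [vcov] contracts m with the second index of [ginv], the matrix product with the first. *)
  rewrite -metric_inv_tr mxE; apply: eq_bigr => c _.
  by rewrite [Gi^T _ _]mxE [row _ _ _ _]mxE [mx_at theta _ _ _]mxE mulrC.
transitivity ((row t M *m Gi *m cov_mx l) 0 a + \tr (Gi *m N t) * l a x
   - \tr (Gi *m cov_mx l) * theta t a x - ((\row_a l a x) *m Gi *m N t) 0 a
   - (row t M *m Gi *m (cov_mx l)^T) 0 a); last by rewrite !mxE.
rewrite /vre rowT_E; congr (_ - _).
rewrite !row_E !tr_E !mulr_suml -!big_split -!sumrB /=; apply: eq_bigr => b _.
rewrite !mulr_suml -!big_split -!sumrB /=; apply: eq_bigr => c _.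
by rewrite cov2_wedge// !mxE -/l; ring.
Qed.

Lemma vre_frame t n : \sum_a vre t a * E a n = frame_v frame_cov t n.
Proof.
set l := lcov theta.
transitivity (((\row_a vre t a) *m E) 0 n).
  by rewrite mxE; apply: eq_bigr => a _; rewrite mxE.
have row_frame k : row k M *m E = delta_mx 0 k by rewrite -row_mul ME row1.
have l_row : \row_a l a x = row i0 M + row i3 M by apply/rowP => a; rewrite !mxE.
have cov_l : cov_mx l = N i0 + N i3.
  by apply/matrixP => c a; rewrite !mxE cov1_lcov.
have GiE : Gi = E *m omx *m E^T := metric_inv_mx.
have half (k j : 'I_4) (A : 'M[R]_4) : (row k M *m Gi *m A *m E) 0 j =
    sgn_o k * (E^T *m A *m E) k j.
  rewrite GiE !mulmxA row_frame -!mulmxA -rowE mxE !mulmxA -!(mulmxA omx).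
  by rewrite mul_omxl.
have trE (A : 'M[R]_4) : \tr (Gi *m A) = \sum_k sgn_o k * (E^T *m A *m E) k k.
  rewrite GiE -!mulmxA mxtrace_mulC -!mulmxA; apply: eq_bigr => k _.
  by rewrite mul_omxl !mulmxA.
have lin (A B : 'M[R]_4) k j : (E^T *m (A + B) *m E) k j =
   (E^T *m A *m E) k j + (E^T *m B *m E) k j.
  by rewrite mulmxDr mulmxDl mxE.
have trED (A B : 'M[R]_4) : \tr (Gi *m (A + B)) =
    \sum_k sgn_o k * ((E^T *m A *m E) k k + (E^T *m B *m E) k k).
  by rewrite trE; apply: eq_bigr => k _; rewrite lin.
rewrite vre_mx !mulmxBl mulmxDl -!scalemxAl row_frame l_row !mulmxDl !row_frame.
have expand (A B C D F G' H : 'rV[R]_4) (r s : R) :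
   (A + r *: (B + C) - s *: D - (F + G') - H) 0 n =
   A 0 n + r * (B 0 n + C 0 n) - s * D 0 n - (F 0 n + G' 0 n) - H 0 n.
  by rewrite !mxE.
have tr_cov : E^T *m (N i0 + N i3)^T *m E = (E^T *m (N i0 + N i3) *m E)^T.
  by rewrite !trmx_mul trmxK mulmxA.
rewrite expand -/l cov_l !half (trE (N t)) trED tr_cov [_^T t n]mxE !lin.
rewrite /frame_v; congr (_ + _ * _ - _ * _ - _ - _).
- by rewrite !mxE.
- by rewrite !mxE.
- by rewrite sum4 !ord4_neq//= !(mul0r, addr0, add0r, mul1r).
Qed.

Lemma vcov_eq0 : (forall a, vcov g theta a x = 0) <->
  forall n, frame_v frame_cov i1 n = 0 /\ frame_v frame_cov i2 n = 0.
Proof.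
split=> [v0 n|f0 a].
  have vre0 a : vre i1 a = 0 /\ vre i2 a = 0.
    by have := v0 a; rewrite vcovE => -[-> ->].
  by rewrite -!vre_frame !big1// => a _; have [h1 h2] := vre0 a; rewrite ?h1 ?h2 mul0r.
have back t : (forall n, frame_v frame_cov t n = 0) -> vre t a = 0.
  move=> fn0; have e : (\row_b vre t b) *m E = 0.
    apply/rowP => n; rewrite [RHS]mxE -(fn0 n) -vre_frame mxE.
    by apply: eq_bigr => b _; rewrite mxE.
  have : (\row_b vre t b) *m E *m M = 0 by rewrite e mul0mx.
  by rewrite -mulmxA EM mulmx1 => /rowP /(_ a); rewrite !mxE.
by rewrite vcovE !back// => n; have [] := f0 n.
Qed.

End FrameGeometry.

(** * The field equations *)

Section FieldEquations.
Context {R : realType}.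
Notation i0 := (inord 0 : 'I_4).
Notation i1 := (inord 1 : 'I_4).
Notation i2 := (inord 2 : 'I_4).
Notation i3 := (inord 3 : 'I_4).

Lemma euler_formZ (p : 'I_4 -> 'I_4 -> R) D F (r : R) :
  euler_form sgn_o p D (fun j k => r * F j k) = r * euler_form sgn_o p D F.
Proof.
rewrite /euler_form mulr_sumr; apply: eq_bigr => j _.
rewrite [RHS]mulrCA; congr (_ * _).
by rewrite mulrDr !mulr_sumr; congr (_ + _); apply: eq_bigr => k _; ring.
Qed.

Lemma sgn_o_sq (j : 'I_4) : sgn_o j * sgn_o j = 1 :> R.
Proof. by rewrite /sgn_o /o eqxx /=; case: ifP; rewrite ?mulr1// mulrNN mulr1. Qed.

(** The elementary antisymmetric matrix in the indices j, k, with its first index raised by [o]. *)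
Definition rotation_generator (j k a b : 'I_4) : R :=
  sgn_o a * (((a == j) && (b == k))%:R - ((a == k) && (b == j))%:R).

Lemma rotation_generator_asym j k : lower_asym (rotation_generator j k).
Proof.
move=> a b; rewrite /rotation_generator !mulrA !sgn_o_sq !mul1r.
by rewrite opprB [(b == k) && _]andbC [(b == j) && _]andbC.
Qed.

Lemma vcov_euler_form (U : set 'rV[R]_4) (g : tensor2 R R) (theta : quartet R)
    (x : 'rV[R]_4) : open U -> U x -> (forall j a, smooth U (theta j a)) ->
  metric_constraint U g theta -> 0 < \det (mx_at theta x) ->
  (forall a, vcov g theta a x = 0) <->
  (forall F, lower_asym F ->
     euler_form sgn_o (values theta x) (partials theta x) F = 0).
Proof.
move=> oU Ux sth mg dth.
have Wm := frame_cov_metric U g theta x oU Ux sth mg dth.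
have Wt := frame_cov_torsion U g theta x oU Ux mg dth.
have eF := euler_form_frame (frame_cov g theta x) Wm _ _ Wt.
have [r13 r23 r22 r21] := frame_v_relations (frame_cov g theta x) Wm.
have Vn0 : vol4 (values theta x i0) (values theta x i1) (values theta x i2)
    (values theta x i3) != 0.
  by rewrite -(det_vol4 (values theta x)) gt_eqF.
rewrite (vcov_eq0 U g theta x Ux sth mg dth); split=> [f0 F Fa|H n].
  have z1 n : frame_v (frame_cov g theta x) i1 n = 0 by have [] := f0 n.
  have z2 n : frame_v (frame_cov g theta x) i2 n = 0 by have [] := f0 n.
  by rewrite eF// !z1 !z2 !mulr0 !(subr0, addr0) mulr0.
have gen j k := etrans (esym (eF _ (rotation_generator_asym j k)))
  (H _ (rotation_generator_asym j k)).
have cancel (r : R) : 2 * vol4 (values theta x i0) (values theta x i1)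
    (values theta x i2) (values theta x i3) * r = 0 -> r = 0.
  by move/eqP; rewrite !mulf_eq0 (negbTE Vn0) pnatr_eq0 /= => /eqP.
(* Up to sign these generators isolate v''_0, v'_0, v'_2 and v'_1; [frame_v_relations] gives the
   other four components. *)
have := (cancel _ (gen i0 i1), cancel _ (gen i0 i2), cancel _ (gen i0 i3), cancel _ (gen i1 i2)).
rewrite /rotation_generator !sgn_oE !ord4_neq//=.
rewrite !(subr0, sub0r, mulr0, mul0r, mul1r, mulr1, mulN1r, add0r, addr0, oppr0, opprK).
move=> [[[h20 h10] h12] h11].
have z10 : frame_v (frame_cov g theta x) i1 i0 = 0 by lra.
have z11 : frame_v (frame_cov g theta x) i1 i1 = 0 by lra.
have : [\/ n = i0, n = i1, n = i2 | n = i3].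
  by case: n => [[|[|[|[|//]]]] ?]; [constructor 1|constructor 2|constructor 3|constructor 4];
    apply/val_inj; rewrite /= inordK.
by case=> ->; rewrite ?r13 ?r23 ?r22 ?r21 ?h12 ?oppr0.
Qed.

Lemma box_nbhs (p : 'rV[R]_4) (P : set 'rV[R]_4) : (\forall y \near p, P y) ->
  exists2 r : R, 0 < r & forall y : 'rV[R]_4, (forall a, `|y 0 a - p 0 a| <= r) -> P y.
Proof.
move=> nP; have [e /= e0 he] : nbhs_ball p P by apply/nbhs_ballP.
(* Halving turns the non-strict inequality of the box into the strict one of the ball. *)
exists (e / 2); first by lra.
move=> y hy; apply: he; split=> // i j; rewrite (ord1 i) -ball_normE /= distrC.
by apply: le_lt_trans (hy j) _; lra.
Qed.

Lemma compact_closed_box (p : 'rV[R]_4) (r : R) :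
  compact [set y : 'rV[R]_4 | forall a, `|y 0 a - p 0 a| <= r].
Proof.
rewrite (_ : [set y | _] = [set y : 'rV[R]_4 | forall a,
    `[p 0 a - r, p 0 a + r]%classic (y ord0 a)]).
  apply: (@rV_compact _ _ (fun a => `[p 0 a - r, p 0 a + r]%classic)) => a.
  exact: segment_compact.
apply/seteqP; split=> y /= hy a; have := hy a; rewrite in_itv/= ler_distl; first by [].
by [].
Qed.

(** Since no derivative of F enters the Euler form, a bump times c yields the bump times the form at
    c. If the latter is positive at [p], it is so on a small box, and a bump supported there has a
    positive integral against it. *)
Lemma euler_vanishes (U : set 'rV[R]_4) (theta : quartet R) : open U ->
  (forall j a, smooth U (theta j a)) ->
  (forall F, admissible U F -> integral_on U (euler theta F) = 0) ->
  forall p, U p -> forall c, lower_asym c ->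
  euler_form sgn_o (values theta p) (partials theta p) c = 0.
Proof.
move=> oU sth int0 p Up.
(* Excluding positive values suffices, because [-c] is antisymmetric as well. *)
suff notpos c : lower_asym c ->
    ~ 0 < euler_form sgn_o (values theta p) (partials theta p) c.
  move=> c ca; apply/eqP; rewrite eq_le !leNgt; apply/andP; split; apply/negP.
    exact: notpos.
  move=> h; apply: (notpos (fun j k => -1 * c j k)).
    by move=> j k; rewrite !(mulrCA _ (-1)) ca mulrN.
  by rewrite euler_formZ mulN1r oppr_gt0.
(* The constant field is no admissible variation; it makes the form at the fixed c a continuous
   function of the point. *)
move=> ca hp; pose Fc : tensor2 R R := fun j k _ => c j k.
have sFc j k : smooth U (Fc j k) by apply: bump_smooth; exact: bump_cst.
have ch : cont_on U (euler theta Fc) := cont_on_euler U theta Fc sth sFc.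
have near_pos : \forall y \near p, U y /\ 0 < euler theta Fc y.
  by apply: filterI; [exact: near_open|exact: (cvgr_gt _ (ch p Up) _ hp)].
have [r r0 hr] := box_nbhs p _ near_pos.
pose K := [set y : 'rV[R]_4 | forall a, `|y 0 a - p 0 a| <= r].
have cK : compact K := compact_closed_box p r.
have KU : K `<=` U by move=> y /hr [].
pose F : tensor2 R R := fun j k y => bump_fun p r y * c j k.
have F0 j k y : ~ K y -> F j k y = 0.
  move=> nK; have [a /negP] : exists a, ~ `|y 0 a - p 0 a| <= r by apply/existsNP.
  by rewrite -ltNge => ya; rewrite /F (bump_eq0 p r y a ya) mul0r.
have sF j k : smooth U (F j k).
  by apply: bump_smooth; apply: bump_mul; [exact: bump_in_algebra|exact: bump_cst].
have aF : admissible U F.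
  split=> //; first by exists K.
  by move=> j k y; rewrite !sum_o /F !(mulrCA _ (bump_fun p r y)) ca mulrN.
have eF y : euler theta F y = bump_fun p r y * euler theta Fc y by exact: euler_formZ.
have cs := cont_supp_euler U K theta F sth sF F0.
have : 0 < integral_on U (euler theta F).
  apply: (integral_on_gt0 U K oU cK KU _ p cs _ Up).
    move=> y Uy; rewrite eF; have [/hr [_ hy]|nK] := pselect (K y).
      by rewrite mulr_ge0 ?bump_ge0// ltW.
    have [a /negP] : exists a, ~ `|y 0 a - p 0 a| <= r by apply/existsNP.
    by rewrite -ltNge => ya; rewrite (bump_eq0 p r y a ya) mul0r.
  by rewrite eF mulr_gt0// bump_gt0.
by rewrite int0// ltxx.
Qed.

End FieldEquations.

Theorem mainTheorem3 (R : realType) (U : set 'rV[R]_4)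
    (g : 'I_4 -> 'I_4 -> 'rV[R]_4 -> R)
    (ref theta : 'I_4 -> 'I_4 -> 'rV[R]_4 -> R) :
  open U -> contractible U ->
  lorentzian U g -> reference_coframe U g ref -> coframe U g ref theta ->
  (euler_lagrange U theta <->
   forall (a : 'I_4) (x : 'rV[R]_4), U x -> vcov g theta a x = 0).
Proof.
move=> oU _ _ _ [sth mg dth _].
have deriv F K : admissible U F -> compact K -> K `<=` U ->
    (forall j k x, ~ K x -> F j k x = 0) -> is_derive (0 : R) (1 : R)
    (fun e : R => action_diff U (varied theta F e) theta)
    (3^-1 * integral_on U (euler theta F)).
  by move=> [sF _ _] cK KU F0; exact: (euler_derive U K theta F oU cK KU sth sF F0).
split=> [EL a x Ux | v0 F aF].
  apply: (vcov_euler_form U g theta x oU Ux sth mg (dth x Ux)).2 => {a} c ca.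
  apply: (euler_vanishes U theta oU sth _ x Ux c ca) => F aF.
  have [_ [K [cK KU F0]] _] := aF.
  (* Two values of one derivative: 0 by the field equations, a third of the integral of the Euler
     form by [deriv]. *)
  have [_ e1] := EL F aF; have [_ e2] := deriv F K aF cK KU F0.
  by move: e2; rewrite e1 => /esym/eqP; rewrite mulf_eq0 invr_eq0 pnatr_eq0 /= => /eqP.
have [_ [K [cK KU F0]] Fa] := aF.
(* Zero is written as a multiple of the Euler form so that [integral_onZ] evaluates its integral. *)
have e0 x : U x -> euler theta F x = 0 * euler theta F x.
  move=> Ux; rewrite mul0r.
  apply: (vcov_euler_form U g theta x oU Ux sth mg (dth x Ux)).1.
    by move=> a; exact: v0.
  by move=> j k; have := Fa j k x; rewrite !sum_o.
have [sF _ _] := aF.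
have cs := cont_supp_euler U K theta F sth sF F0.
have := deriv F K aF cK KU F0.
by rewrite (eq_integral_on U _ _ e0) (integral_onZ U K oU cK KU _ _ cs) mul0r mulr0.
Qed.
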